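(* Let $n\ge 2$ and let $M$ be a compact minimal hypersurface in the unit sphere $S^n\subset\mathbb{R}^{n+1}$. If the image of $M$ under the normal Gauss map $\gamma:M\to S^n$ omits a closed half-equator $\overline{S}^{n-1}_+$, i.e. $\gamma(M)\subset S^n\setminus\overline{S}^{n-1}_+$, then $M$ is an equator of $S^n$ (a totally geodesic $(n-1)$-dimensional subsphere).
   Context: A closed half-equator is any set of the form $\overline{S}^{n-1}_+=\{x\in S^n:(x,e_1)=0,\ (x,e_2)\ge 0\}$, where $e_1,e_2\in S^n$ are orthogonal vectors and $(\cdot,\cdot)$ is the Euclidean inner product. The normal Gauss map $\gamma$ sends $x\in M$ to the (oriented) normal line $N_xM$ of $M$ in $S^n$, parallel translated in $\mathbb{R}^{n+1}$ to the origin; the Grassmannian of oriented lines is identified with $S^n$, so $\gamma(x)$ is the unit normal vector of $M$ in $S^n$ at $x$. Manifolds are connected, and compact manifolds are without boundary. *)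

(* Defs.v *)
From HB Require Import structures.
From mathcomp Require Import all_boot all_order all_algebra.
From mathcomp Require Import all_classical all_reals all_analysis.
Import Order.TTheory GRing.Theory Num.Theory.
Import numFieldNormedType.Exports.

Set Implicit Arguments.
Unset Strict Implicit.
Unset Printing Implicit Defensive.

Local Open Scope classical_set_scope.
Local Open Scope ring_scope.

Definition dot (R : realType) (k : nat) (u v : 'rV[R]_k) : R :=
  \sum_(i < k) u 0 i * v 0 i.

Definition unit_sphere (R : realType) (n : nat) : set 'rV[R]_n.+1 :=
  [set x | dot x x = 1].
Arguments unit_sphere : clear implicits.

Definition half_equator (R : realType) (n : nat) (e1 e2 : 'rV[R]_n.+1) :
    set 'rV[R]_n.+1 :=
  [set x | [/\ unit_sphere R n x, dot x e1 = 0 & 0 <= dot x e2]].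

(* The totally geodesic (n-1)-spheres of S^n are its intersections with the
   linear hyperplanes a^\perp. *)
Definition is_equator (R : realType) (n : nat) (E : set 'rV[R]_n.+1) : Prop :=
  exists2 a, unit_sphere R n a & E = [set x | unit_sphere R n x /\ dot x a = 0].

(* Only meaningful when A is open: derivatives are those of the total function
   f, so they use the values of f on a neighbourhood of each point of A. *)
Fixpoint class_C (R : realType) (V W : normedModType R) (k : nat)
    (A : set V) (f : V -> W) : Prop :=
  if k is k'.+1 then
    (forall x, A x -> differentiable f x) /\
    (forall v : V, class_C k' A ('D_v f))
  else forall x, A x -> {for x, continuous f}.

Definition smooth_on (R : realType) (V W : normedModType R)
    (A : set V) (f : V -> W) : Prop :=
  forall k, class_C k A f.

(* chart_map and chart_inv are total functions; only their values on the chart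
   domain and on its image matter. *)
Record chart (R : realType) (m : nat) (M : topologicalType) := Chart {
  chart_dom : set M;
  chart_map : M -> 'rV[R]_m;
  chart_inv : 'rV[R]_m -> M
}.

Definition chart_img (R : realType) (m : nat) (M : topologicalType)
    (c : chart R m M) : set 'rV[R]_m :=
  chart_map c @` chart_dom c.

Definition is_chart (R : realType) (m : nat) (M : topologicalType)
    (c : chart R m M) : Prop :=
  [/\ open (chart_dom c),
      open (chart_img c),
      forall p, chart_dom c p -> chart_inv c (chart_map c p) = p,
      forall p, chart_dom c p -> {for p, continuous (chart_map c)} &
      forall x, chart_img c x -> {for x, continuous (chart_inv c)}].

Definition smooth_atlas (R : realType) (m : nat) (M : topologicalType)
    (A : set (chart R m M)) : Prop :=
  [/\ forall c, A c -> is_chart c,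
      forall p : M, exists2 c, A c & chart_dom c p &
      forall c d, A c -> A d ->
        smooth_on (chart_map c @` (chart_dom c `&` chart_dom d))
                  (chart_map d \o chart_inv c)].

(* Charts take values in open subsets of R^m, so there is no boundary; second
   countability is automatic for a compact space covered by charts. *)
Definition compact_connected_manifold (R : realType) (m : nat)
    (M : topologicalType) (A : set (chart R m M)) : Prop :=
  [/\ hausdorff_space M,
      compact [set: M],
      connected [set: M],
      [set: M] !=set0 &
      smooth_atlas A].

Definition smooth_map (R : realType) (m k : nat) (M : topologicalType)
    (A : set (chart R m M)) (f : M -> 'rV[R]_k) : Prop :=
  forall c, A c -> smooth_on (chart_img c) (f \o chart_inv c).

Definition immersion (R : realType) (m k : nat) (M : topologicalType)
    (A : set (chart R m M)) (f : M -> 'rV[R]_k) : Prop :=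
  smooth_map A f /\
  forall c x, A c -> chart_img c x -> injective ('d (f \o chart_inv c) x).

Definition sphere_hypersurface (R : realType) (n : nat) (M : topologicalType)
    (A : set (chart R n.-1 M)) (f : M -> 'rV[R]_n.+1) : Prop :=
  immersion A f /\ (forall p, unit_sphere R n (f p)).

(* The oriented normal line of M in S^n at p, as the unit vector spanning it:
   tangent to S^n at f p, i.e. orthogonal to f p, and orthogonal to M. *)
Definition gauss_map (R : realType) (n : nat) (M : topologicalType)
    (A : set (chart R n.-1 M)) (f gam : M -> 'rV[R]_n.+1) : Prop :=
  [/\ smooth_map A gam,
      forall p, unit_sphere R n (gam p),
      forall p, dot (gam p) (f p) = 0 &
      forall c x v, A c -> chart_img c x ->
        dot (gam (chart_inv c x)) ('d (f \o chart_inv c) x v) = 0].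

Definition partial (R : realType) (m k : nat) (i : 'I_m)
    (F : 'rV[R]_m -> 'rV[R]_k) : 'rV[R]_m -> 'rV[R]_k :=
  'D_(delta_mx 0 i) F.

Definition first_form (R : realType) (m k : nat)
    (F : 'rV[R]_m -> 'rV[R]_k) (x : 'rV[R]_m) : 'M[R]_m :=
  \matrix_(i, j) dot (partial i F x) (partial j F x).

(* Second fundamental form in S^n of the parametrization F with unit normal N.
   The Levi-Civita connection of S^n is the tangential projection of the flat
   one, and N is tangent to S^n, so pairing the flat second derivative with N
   needs no correction. *)
Definition second_form (R : realType) (m k : nat)
    (F N : 'rV[R]_m -> 'rV[R]_k) (x : 'rV[R]_m) : 'M[R]_m :=
  \matrix_(i, j) dot (partial i (partial j F) x) (N x).

Definition mean_curvature (R : realType) (m k : nat)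
    (F N : 'rV[R]_m -> 'rV[R]_k) (x : 'rV[R]_m) : R :=
  \tr (invmx (first_form F x) *m second_form F N x).

(* gam is a unit normal field along f; replacing it by its opposite changes the
   sign of the mean curvature only. *)
Definition minimal (R : realType) (n : nat) (M : topologicalType)
    (A : set (chart R n.-1 M)) (f gam : M -> 'rV[R]_n.+1) : Prop :=
  forall c x, A c -> chart_img c x ->
    mean_curvature (f \o chart_inv c) (gam \o chart_inv c) x = 0.

(* Main.v *)
Require Import Defs.
From HB Require Import structures.
From mathcomp Require Import all_boot all_order all_algebra.
From mathcomp Require Import all_classical all_reals all_analysis.
From mathcomp Require Import perm ring lra.
Import Order.TTheory GRing.Theory Num.Theory.
Import numFieldNormedType.Exports.
Local Open Scope classical_set_scope.
Local Open Scope ring_scope.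

(** Let [u = (gam, e1)] and [v = (gam, e2)] be the components of the Gauss map
    along the two vectors that span the plane of the half-equator.  Omitting
    the half-equator means that [(u, v)] never meets the ray [u = 0, v >= 0], so
    that the angle of [(u, v)] is a well defined continuous function on the
    hypersurface, with values in an interval of length [2 pi].

    By the Codazzi equation, minimality gives [Delta gam = - |B|^2 gam]: every
    component [(gam, a)] solves an elliptic equation, and is superharmonic
    wherever it is nonnegative ([laplacian_gauss_map], [elliptic_op_gauss_map]).
    The strong minimum principle ([strong_minimum_principle], proved after Hopf)
    therefore applies to such a component near a point where it is minimal.
    Three applications prove that [gam] is constant.
    - At a point where the angle is maximal, choose [a] in the plane of [e1] and
      [e2] so that [(gam, a)] is a positive multiple of the sine of the maximal
      angle minus the angle.  Nearby it is nonnegative, and it vanishes at the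
      point, hence vanishes near it: the set where the angle is maximal is open.
      As it is also closed, the angle is constant by connectedness.
    - Then [(u, v)] stays on an open half-line, and its component along this
      half-line is positive on the whole of [M]; the component attains its
      minimum because [M] is compact, so it is constant.
    - Adding a large multiple of this positive constant to any other component
      makes that one positive, hence constant as well ([gauss_constant]).

    If [gam = g] is constant then the hypersurface lies in the equator
    orthogonal to [g].  It covers it ([gauss_constant_equator]): given [q] on
    the equator, at a point where [(f, q)] is maximal [q] is orthogonal to the
    tangent space and to [g], so [f = q] or [f = - q] there; in the second case
    the maximum of [(f, q)] is [-1], [f] is identically [- q], and is no
    immersion.

    Everything local is computed in a chart.  The elliptic operator is written
    with flat partial derivatives; its coefficients are the inverse of the first
    fundamental form and a drift. *)

(** * The Euclidean scalar product *)

Section DotProduct.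
Context {R : realType} {k : nat}.
Implicit Types (u v w : 'rV[R]_k) (c : R).

Lemma dotC u v : dot u v = dot v u.
Proof. by apply: eq_bigr => i _; rewrite mulrC. Qed.

Lemma dotDl u v w : dot (u + v) w = dot u w + dot v w.
Proof. by rewrite /dot -big_split; apply: eq_bigr => i _; rewrite mxE mulrDl. Qed.

Lemma dotZl c u v : dot (c *: u) v = c * dot u v.
Proof. by rewrite /dot mulr_sumr; apply: eq_bigr => i _; rewrite mxE mulrA. Qed.

Lemma dotNl u v : dot (- u) v = - dot u v.
Proof. by rewrite -scaleN1r dotZl mulN1r. Qed.

Lemma dotBl u v w : dot (u - v) w = dot u w - dot v w.
Proof. by rewrite dotDl dotNl. Qed.

Lemma dot0l u : dot 0 u = 0.
Proof. by rewrite -(scale0r 0) dotZl mul0r. Qed.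

Lemma dotDr u v w : dot w (u + v) = dot w u + dot w v.
Proof. by rewrite !(dotC w) dotDl. Qed.

Lemma dotZr c u v : dot v (c *: u) = c * dot v u.
Proof. by rewrite !(dotC v) dotZl. Qed.

Lemma dotNr u v : dot v (- u) = - dot v u.
Proof. by rewrite !(dotC v) dotNl. Qed.

Lemma dotBr u v w : dot w (u - v) = dot w u - dot w v.
Proof. by rewrite !(dotC w) dotBl. Qed.

Lemma dot0r u : dot u 0 = 0.
Proof. by rewrite dotC dot0l. Qed.

Lemma dot_suml (I : finType) (F : I -> 'rV[R]_k) u :
  dot (\sum_i F i) u = \sum_i dot (F i) u.
Proof. by elim/big_rec2: _ => [|i x y _ <-]; rewrite ?dot0l ?dotDl. Qed.

Lemma dot_mulmx u v : dot u v = (u *m v^T) 0 0.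
Proof. by rewrite mxE; apply: eq_bigr => i _; rewrite mxE. Qed.

Lemma dot_delta u i : dot u (delta_mx 0 i) = u 0 i.
Proof.
rewrite /dot (bigD1 i) //= big1 => [|j /negbTE ji].
  by rewrite mxE !eqxx mulr1 addr0.
by rewrite mxE ji andbF mulr0.
Qed.

Lemma dot_ge0 u : 0 <= dot u u.
Proof. by apply: sumr_ge0 => i _; rewrite -expr2 sqr_ge0. Qed.

Lemma dot_eq0 u : dot u u = 0 -> u = 0.
Proof.
move=> /eqP; rewrite psumr_eq0 => [|i _]; last by rewrite -expr2 sqr_ge0.
move=> /allP u0; apply/rowP => i; apply/eqP; rewrite mxE.
by move: (u0 i (mem_index_enum i)); rewrite -expr2 sqrf_eq0.
Qed.

Lemma dot_gt0 u : u != 0 -> 0 < dot u u.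
Proof.
move=> u0; rewrite lt_neqAle dot_ge0 andbT eq_sym.
by apply: contra_neq u0 => /dot_eq0.
Qed.

Lemma ler_coord_dot u i : u 0 i ^+ 2 <= dot u u.
Proof.
rewrite /dot (bigD1 i) //= -expr2 lerDl; apply: sumr_ge0 => j _.
by rewrite -expr2 sqr_ge0.
Qed.

Lemma dotD_le u v : dot (u + v) (u + v) <= 2 * dot u u + 2 * dot v v.
Proof.
have := dot_ge0 (u - v); rewrite dotBl !dotBr dotDl !dotDr (dotC v u); lra.
Qed.

End DotProduct.

(** * Directional derivatives *)

Section DirectionalDerivatives.
Context {R : realType}.

Lemma derive_line {V W : normedModType R} {f : V -> W} {x v : V} {t : R} :
  derivable f (x + t *: v) v ->
  is_derive t 1 (fun s : R => f (x + s *: v)) ('D_v f (x + t *: v)).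
Proof.
have E : (fun h : R => h^-1 *: (((fun s : R => f (x + s *: v)) \o shift t)
      (h *: (1 : R)) - f (x + t *: v))) =
    (fun h => h^-1 *: ((f \o shift (x + t *: v)) (h *: v) - f (x + t *: v))).
  apply/funext => h /=; congr (_ *: (f _ - _)).
  by rewrite [h *: 1]mulr1 scalerDl addrCA.
by move=> fd; split; rewrite /derivable /derive E.
Qed.

Lemma MVT_line {V : normedModType R} (f : V -> R) (x v : V) (h : R) : 0 < h ->
  (forall t, 0 <= t <= h -> derivable f (x + t *: v) v) ->
  exists2 t, 0 < t < h & f (x + h *: v) - f x = 'D_v f (x + t *: v) * h.
Proof.
move=> h0 fd.
have d t : 0 <= t <= h ->
    is_derive t 1 (fun s : R => f (x + s *: v)) ('D_v f (x + t *: v)).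
  by move=> /fd; exact: derive_line.
have [t|| t] := @MVT R (fun s : R => f (x + s *: v))
  (fun t => 'D_v f (x + t *: v)) _ _ h0.
- by rewrite in_itv /= => /andP[t0 th]; apply: d; rewrite !ltW.
- apply: derivable_within_continuous => t; rewrite in_itv /= => /d.
  by case.
by rewrite in_itv /= scale0r addr0 subr0 => th; exists t.
Qed.

Lemma near_line {V : normedModType R} (P : V -> Prop) (x v : V) :
  (\forall y \near x, P y) ->
  exists2 h : R, 0 < h & forall t, `|t| <= h -> P (x + t *: v).
Proof.
move=> /nbhs_ballP[e /= e0 Pe].
have v1 : 0 < `|v| + 1 by rewrite ltr_wpDl.
exists (e / 2 / (`|v| + 1)) => [|t th]; first by rewrite !divr_gt0.
apply: Pe; rewrite -ball_normE /= opprD addNKr normrN normrZ.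
have te : `|t| * (`|v| + 1) <= e / 2 by rewrite -ler_pdivlMr.
apply: (@le_lt_trans _ _ (`|t| * (`|v| + 1))).
  by rewrite ler_wpM2l ?lerDl.
by apply: (le_lt_trans te); rewrite ltr_pdivrMr // ltr_pMr ?ltr1n.
Qed.

Lemma derivable_coord {V : normedModType R} {m n} (F : V -> 'M[R]_(m, n)) x v i j :
  derivable F x v -> derivable (fun y => F y i j) x v.
Proof. by move=> /derivable_mxP. Qed.

Lemma derive_coord {V : normedModType R} {m n} (F : V -> 'M[R]_(m, n)) x v i j :
  derivable F x v -> 'D_v (fun y => F y i j) x = 'D_v F x i j.
Proof. by move=> /derive_mx ->; rewrite mxE. Qed.

Lemma differentiable_entry {V : normedModType R} {m n} (F : V -> 'M[R]_(m, n)) x i j :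
  differentiable F x -> differentiable (fun y => F y i j) x.
Proof.
by move=> dF; exact: (differentiable_comp dF (differentiable_coord (F x) i j)).
Qed.

Lemma is_derive_dot {V : normedModType R} {k} (F G : V -> 'rV[R]_k) x v dF dG :
  is_derive x v F dF -> is_derive x v G dG ->
  is_derive x v (fun y => dot (F y) (G y)) (dot dF (G x) + dot (F x) dG).
Proof.
move=> [Fd <-] [Gd <-].
have -> : (fun y => dot (F y) (G y)) =
    \sum_(i < k) ((fun y => F y 0 i) * (fun y => G y 0 i)).
  by apply/funext => y; rewrite fct_sumE.
have -> : dot ('D_v F x) (G x) + dot (F x) ('D_v G x) =
   \sum_(i < k) (F x 0 i *: 'D_v (fun y => G y 0 i) x +
                 G x 0 i *: 'D_v (fun y => F y 0 i) x).
  rewrite /dot -big_split; apply: eq_bigr => i _ /=.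
  rewrite (derive_coord F x v 0 i Fd) (derive_coord G x v 0 i Gd) addrC.
  by congr (_ + _); exact: mulrC.
apply: is_derive_sum => i; apply: is_deriveM; apply: derivableP;
  exact: derivable_coord.
Qed.

Lemma derive_dot {V : normedModType R} {k} (F G : V -> 'rV[R]_k) x v :
  derivable F x v -> derivable G x v ->
  'D_v (fun y => dot (F y) (G y)) x = dot ('D_v F x) (G x) + dot (F x) ('D_v G x).
Proof.
by move=> /derivableP dF /derivableP dG; have [_ ->] := is_derive_dot _ _ _ _ _ _ dF dG.
Qed.

Lemma derive_dotr {V : normedModType R} {k} (F : V -> 'rV[R]_k) a x v :
  derivable F x v -> 'D_v (fun y => dot (F y) a) x = dot ('D_v F x) a.
Proof.
move=> /derivableP dF.
have [_ ->] := is_derive_dot F (cst a) x v _ _ dF (is_derive_cst a x v).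
by rewrite dot0r addr0.
Qed.

Lemma differentiable_bigsum {V W : normedModType R} {I : finType} (f : I -> V -> W) x :
  (forall i, differentiable (f i) x) -> differentiable (fun y => \sum_i f i y) x.
Proof.
move=> df; rewrite (_ : (fun _ => _) = \sum_i f i); last first.
  by apply/funext => y; rewrite fct_sumE.
elim/big_ind : _ => [|g h dg dh|i _]; last exact: df.
  exact: differentiable_cst.
exact: differentiableD.
Qed.

Lemma differentiable_bigprod {V : normedModType R} {I : finType} (f : I -> V -> R) x :
  (forall i, differentiable (f i) x) -> differentiable (fun y => \prod_i f i y) x.
Proof.
move=> df; rewrite (_ : (fun _ => _) = \big[(fun f g => f * g)/cst 1]_i f i); last first.
  by apply/funext => y; elim/big_rec2: _ => // i u v _ ->.
elim/big_ind : _ => [|g h dg dh|i _]; last exact: df.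
  exact: differentiable_cst.
exact: differentiableM.
Qed.

Lemma differentiable_dot {V : normedModType R} {k} (F G : V -> 'rV[R]_k) x :
  differentiable F x -> differentiable G x ->
  differentiable (fun y => dot (F y) (G y)) x.
Proof.
move=> dF dG; apply: differentiable_bigsum => i.
by apply: (@differentiableM _ _ (fun y => F y 0 i) (fun y => G y 0 i));
  exact: differentiable_entry.
Qed.

Lemma derive_coords {W : normedModType R} {m} (f : 'rV[R]_m -> W) x (u : 'rV[R]_m) :
  differentiable f x -> 'D_u f x = \sum_i u 0 i *: 'D_(delta_mx 0 i) f x.
Proof.
move=> df; rewrite deriveE // {1}[u]row_sum_delta linear_sum.
by apply: eq_bigr => i _; rewrite linearZ -deriveE.
Qed.

End DirectionalDerivatives.

(** * Symmetry of second derivatives and local minima *)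

Section SecondOrder.
Context {R : realType} {V : normedModType R}.

(** The mean value theorem, used first in the direction [v] for the increment of
    [f] along [w], then in the direction [w]. *)
Lemma second_difference (f : V -> R) (x v w : V) (h : R) : 0 < h ->
  (forall s t, 0 <= s <= h -> 0 <= t <= h ->
    derivable f (x + s *: v + t *: w) v /\
    derivable ('D_v f) (x + s *: v + t *: w) w) ->
  exists s t, [/\ 0 < s < h, 0 < t < h &
    f (x + h *: v + h *: w) - f (x + h *: v) - (f (x + h *: w) - f x) =
    'D_w ('D_v f) (x + s *: v + t *: w) * h * h].
Proof.
move=> h0 fd; have h0' := ltW h0.
have hh : 0 <= h <= h by rewrite h0' lexx.
have oo : 0 <= (0 : R) <= h by rewrite h0' lexx.
pose g (s : R) := f (x + h *: w + s *: v) - f (x + s *: v).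
pose dg (s : R) := 'D_v f (x + h *: w + s *: v) - 'D_v f (x + s *: v).
have gd s : 0 <= s <= h -> is_derive s 1 g (dg s).
  move=> sh; apply: is_deriveB; apply: derive_line.
    have [fdv _] := fd s h sh hh; rewrite addrAC; exact: fdv.
  have [fdv _] := fd s 0 sh oo; rewrite scale0r addr0 in fdv; exact: fdv.
have [s|s|s] := @MVT R g dg 0 h h0.
- by rewrite in_itv /= => /andP[s0 sh]; apply: gd; rewrite !ltW.
- by apply: derivable_within_continuous => {}s; rewrite in_itv /= => /gd[].
rewrite in_itv /= => sh; have sh' : 0 <= s <= h by case/andP: sh => *; rewrite !ltW.
have [t th E] := MVT_line ('D_v f) (x + s *: v) w h h0
                   (fun t th => proj2 (fd s t sh' th)).
rewrite /g /dg !scale0r !addr0 subr0 [x + h *: w + s *: v]addrAC E => gE.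
by exists s, t; rewrite sh th; split=> //; rewrite -gE [x + h *: w + _]addrAC; ring.
Qed.

Lemma eq_of_adherent_values {T : topologicalType} (p q : T -> R) (x : T) :
  {for x, continuous p} -> {for x, continuous q} ->
  (forall P : T -> Prop, (\forall y \near x, P y) ->
     exists y z, [/\ P y, P z & p y = q z]) ->
  p x = q x.
Proof.
move=> cp cq H; apply: contrapT => /eqP pq.
have e0 : 0 < `|p x - q x| / 2 by rewrite divr_gt0 // normr_gt0 subr_eq0.
have /cvgrPdist_lt /(_ _ e0) np := cp; have /cvgrPdist_lt /(_ _ e0) nq := cq.
have [|y [z [[py _] [_ qz] E]]] := H (fun y => `|p x - p y| < `|p x - q x| / 2 /\
                          `|q x - q y| < `|p x - q x| / 2).
  by near=> y; split; near: y.
have := ler_distD (p y) (p x) (q x); move: py qz; rewrite -E [`|q x - _|]distrC.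
lra.
Unshelve. all: by end_near. Qed.

Lemma near_parallelogram (P : V -> Prop) (x v w : V) :
  (\forall y \near x, P y) -> exists2 h : R, 0 < h &
  forall s t, 0 <= s <= h -> 0 <= t <= h -> P (x + s *: v + t *: w).
Proof.
move=> /nbhs_ballP[e /= e0 Pe].
have v1 : 0 < `|v| + `|w| + 1 by rewrite ltr_wpDl ?addr_ge0.
exists (e / 2 / (`|v| + `|w| + 1)) => [|s t /andP[s0 sh] /andP[t0 th]].
  by rewrite !divr_gt0.
set h := e / 2 / _ in sh th.
apply: Pe; rewrite -ball_normE /= -addrA opprD addNKr normrN.
apply: (le_lt_trans (ler_normD _ _)); rewrite !normrZ !ger0_norm //.
apply: (@le_lt_trans _ _ (h * (`|v| + `|w| + 1))); last first.
  by rewrite /h divfK ?gt_eqF // ltr_pdivrMr // ltr_pMr ?ltr1n.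
rewrite !mulrDr mulr1.
have h0 : 0 <= h by apply: le_trans sh.
by rewrite -[X in X <= _]addr0 lerD // lerD // ler_wpM2r.
Qed.

(** Schwarz: the second difference quotient over a parallelogram is symmetric in
    its two sides, and each mixed derivative takes its value somewhere in every
    small parallelogram. *)
Lemma derive_comm (f : V -> R) (x v w : V) :
  (\forall y \near x, derivable f y v /\ derivable f y w) ->
  (\forall y \near x, derivable ('D_v f) y w /\ derivable ('D_w f) y v) ->
  {for x, continuous ('D_w ('D_v f))} ->
  {for x, continuous ('D_v ('D_w f))} ->
  'D_w ('D_v f) x = 'D_v ('D_w f) x.
Proof.
move=> d1 d2 c1 c2; apply: (eq_of_adherent_values _ _ _ c1 c2) => P nP.
have [h h0 H] := near_parallelogram _ x v w (filterI nP (filterI d1 d2)).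
have [|s [t [/andP[/ltW s0 /ltW sh] /andP[/ltW t0 /ltW th] E1]]] :=
    second_difference f x v w h h0.
  by move=> s t sh th; have [_ [[fv _] [fvw _]]] := H s t sh th; exact: conj.
have [|s' [t' [/andP[/ltW s0' /ltW sh'] /andP[/ltW t0' /ltW th'] E2]]] :=
    second_difference f x w v h h0.
  move=> s' t' sh' th'; rewrite addrAC.
  have [_ [[_ fw] [_ fwv]]] := H t' s' th' sh'; exact: (conj fw fwv).
exists (x + s *: v + t *: w), (x + s' *: w + t' *: v); split.
- by have [||] := H s t; rewrite ?s0 ?t0.
- by rewrite addrAC; have [||] := H t' s'; rewrite ?s0' ?t0'.
have hn : h != 0 by rewrite gt_eqF.
apply: (mulIf hn); apply: (mulIf hn); apply: (etrans (esym E1)).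
apply: (etrans _ E2); rewrite [x + h *: w + _]addrAC; ring.
Qed.

Lemma derive_local_min (f : V -> R) (x v : V) :
  (\forall y \near x, derivable f y v) ->
  (\forall y \near x, f x <= f y) ->
  'D_v f x = 0.
Proof.
move=> fd fm; have [h h0 H] := near_line (fun y => derivable f y v /\ f x <= f y) x v
  (filterI fd fm).
have x0 : x = x + 0 *: v by rewrite scale0r addr0.
have fx0 : derivable f (x + 0 *: v) v by rewrite -x0; exact: nbhs_singleton fd.
have d := derive_line fx0; rewrite -x0 in d.
have [hh H0] : `|-h| <= h /\ `|h| <= h by rewrite normrN gtr0_norm.
have I t : t \in `]-h, h[ -> `|t| <= h.
  by rewrite in_itv /= ler_norml => /andP[a b]; rewrite !ltW.
have := @derive1_at_min R (fun s : R => f (x + s *: v)) (- h) h 0.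
rewrite gt0_cp // => /(_ isT) D.
suff [_ <-] : is_derive (0 : R) 1 (fun s : R => f (x + s *: v)) 0 by case: d => _ ->.
apply: D => [t /I /H [ft _]||t /I /H [_ ft]].
- by have [] := derive_line ft.
- by rewrite in_itv /= oppr_lt0 h0.
- by rewrite scale0r addr0.
Qed.

(** Otherwise the derivative would be negative just after [x], where by the mean
    value theorem [f] would drop below [f x]. *)
Lemma derive2_local_min (f : V -> R) (x v : V) :
  (\forall y \near x, derivable f y v) ->
  derivable ('D_v f) x v ->
  (\forall y \near x, f x <= f y) ->
  0 <= 'D_v ('D_v f) x.
Proof.
move=> fd f2 fm; rewrite leNgt; apply/negP => neg.
have D0 := derive_local_min f x v fd fm.
have /cvgrPdist_lt /(_ (- 'D_v ('D_v f) x)) := f2; rewrite oppr_gt0 => /(_ neg).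
move=> /nbhs_ballP[e /= e0 E].
have [h h0 H] := near_line (fun y => derivable f y v /\ f x <= f y) x v
  (filterI fd fm).
pose k := Num.min h (e / 2); have k0 : 0 < k by rewrite lt_min h0 divr_gt0.
have [kh ke] : k <= h /\ k <= e / 2 by rewrite !ge_min !lexx ?orbT.
have [|t /andP[t0 tk] tE] := MVT_line f x v k k0.
  by move=> t /andP[t0 tk]; have [|//] := H t; rewrite ger0_norm // (le_trans tk).
have [|_] := H k; first by rewrite gtr0_norm.
rewrite -subr_ge0 tE pmulr_lge0 // leNgt => /negP; apply.
have te : t < e.
  by apply: (lt_le_trans tk); apply: (le_trans ke); move: e0; lra.
have bt : ball (0 : R) e t by rewrite -ball_normE /= sub0r normrN gtr0_norm.
have tn : t != 0 by rewrite gt_eqF.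
have : `|'D_v ('D_v f) x - t^-1 *: ('D_v f (t *: v + x) - 'D_v f x)| <
    - 'D_v ('D_v f) x := E t bt tn.
rewrite D0 ltr_norml opprK => /andP[+ _].
rewrite ltrDl oppr_gt0 subr0 /GRing.scale /= [t *: v + x]addrC pmulr_rlt0 //.
by rewrite invr_gt0.
Qed.

End SecondOrder.

(** * Continuity, Euclidean balls and compactness *)

Section PointwiseContinuity.
Context {R : realType} {T : topologicalType}.
Implicit Types (f g : T -> R) (p : T).

Lemma continuous_at_cst (r : R) p : {for p, continuous (fun _ : T => r)}.
Proof. exact: (@cst_continuous T R r p). Qed.

Lemma continuous_at_add f g p : {for p, continuous f} -> {for p, continuous g} ->
  {for p, continuous (fun q => f q + g q)}.
Proof. by move=> cf cg; apply: cvgD. Qed.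

Lemma continuous_at_sub f g p : {for p, continuous f} -> {for p, continuous g} ->
  {for p, continuous (fun q => f q - g q)}.
Proof. by move=> cf cg; apply: cvgB. Qed.

Lemma continuous_at_mul f g p : {for p, continuous f} -> {for p, continuous g} ->
  {for p, continuous (fun q => f q * g q)}.
Proof. by move=> cf cg; apply: cvgM. Qed.

Lemma continuous_at_sum {I : finType} (F : I -> T -> R) p :
  (forall i, {for p, continuous (F i)}) ->
  {for p, continuous (fun q => \sum_i F i q)}.
Proof.
by move=> cF; apply: cvg_big => [|i _]; [exact: add_continuous | exact: cF].
Qed.

Lemma continuous_at_near_eq f g p : (\forall q \near p, f q = g q) ->
  {for p, continuous f} -> {for p, continuous g}.
Proof.
move=> fg cf; rewrite /prop_for /continuous_at -(nbhs_singleton fg).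
by apply: cvg_trans cf; exact: near_eq_cvg.
Qed.

Lemma continuous_at_entry {m n} (F : T -> 'M[R]_(m, n)) p i j :
  {for p, continuous F} -> {for p, continuous (fun q => F q i j)}.
Proof.
move=> cF; apply: (@continuous_comp _ _ _ F (fun N : 'M[R]_(m, n) => N i j)) => //.
exact: coord_continuous.
Qed.

Lemma continuous_at_dot {k} (F G : T -> 'rV[R]_k) p :
  {for p, continuous F} -> {for p, continuous G} ->
  {for p, continuous (fun q => dot (F q) (G q))}.
Proof.
move=> cF cG; apply: continuous_at_sum => i.
by apply: continuous_at_mul; exact: continuous_at_entry.
Qed.

End PointwiseContinuity.

Section EuclideanBalls.
Context {R : realType} {m : nat}.
Implicit Types (x y z u : 'rV[R]_m).

Lemma continuous_at_dot_sub z u x : {for x, continuous (fun y => dot (y - z) u)}.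
Proof.
apply: continuous_at_dot; last exact: (@cst_continuous 'rV[R]_m 'rV[R]_m u x).
exact: (@cvgB _ _ _ (nbhs x) _ id (cst z) x z cvg_id (cvg_cst _)).
Qed.

Lemma near_dot_ball x (P : 'rV[R]_m -> Prop) : (\forall y \near x, P y) ->
  exists2 d : R, 0 < d & forall y, dot (y - x) (y - x) <= d -> P y.
Proof.
move=> /nbhs_ballP[e /= e0 Pe]; exists ((e / 2) ^+ 2) => [|y yd].
  by rewrite exprn_gt0 // divr_gt0.
apply: Pe; split=> // i j; rewrite ord1 -ball_normE /= distrC.
have := le_trans (ler_coord_dot (y - x) j) yd; rewrite !mxE.
have e2 : 0 <= e / 2 by rewrite divr_ge0 ?ltW.
rewrite -[X in X <= _]real_normK ?num_real // ler_pXn2r ?nnegrE // => /le_lt_trans; apply.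
by rewrite ltr_pdivrMr // ltr_pMr ?ltr1n.
Qed.

Lemma dot_sub_continuous z : continuous (fun x => dot (x - z) (x - z)).
Proof.
move=> x; have c : {for x, continuous (fun y => y - z)}.
  exact: (@cvgB _ _ _ (nbhs x) _ id (cst z) x z cvg_id (cvg_cst _)).
exact: (continuous_at_dot _ _ _ c c).
Qed.

Lemma dot_ball_near x d : 0 < d -> \forall y \near x, dot (y - x) (y - x) < d.
Proof.
move=> d0; apply: (cvgr_lt _ (dot_sub_continuous x x)).
by rewrite subrr dot0l.
Qed.

Lemma dot_ball_closed z d : closed [set x | dot (x - z) (x - z) <= d].
Proof.
have /continuous_closedP /(_ _ (@closed_le R d)) := dot_sub_continuous z; exact.
Qed.

Lemma dot_ball_compact z d : compact [set x | dot (x - z) (x - z) <= d].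
Proof.
have := @rV_compact R m (fun i => `[z 0 i - (d + 1), z 0 i + (d + 1)]%classic).
move=> /(_ (fun i => @segment_compact R _ _)).
move=> box; apply: (subclosed_compact _ box); first exact: dot_ball_closed.
move=> x /= xd i.
have := le_trans (ler_coord_dot (x - z) i) xd; rewrite !mxE => h.
(* With s = x i - z i, these say that s and - s are at most s ^ 2 + 1. *)
have h1 := sqr_ge0 (x 0 i - z 0 i + 1 / 2); have h2 := sqr_ge0 (x 0 i - z 0 i - 1 / 2).
rewrite in_itv /= (_ : ord0 = 0) //; move: h h1 h2; rewrite !expr2.
by move: (x 0 i) (z 0 i) => a b *; apply/andP; split; nra.
Qed.

(** Continuity is assumed at the points of [C] in the ambient space, because this
    is for functions that are well behaved on an open set containing [C]. *)
Lemma compact_constraint {T : topologicalType} (C : set T) (f : T -> R) (D : set R) :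
  compact C -> closed C -> (forall p : T, C p -> {for p, continuous f}) -> closed D ->
  compact [set p | C p /\ D (f p)].
Proof.
move=> Cc Cl fc Dl; apply: (subclosed_compact _ Cc) => [|x []//].
rewrite closedE => p np.
have Cp : C p.
  move: (Cl); rewrite closedE; apply=> nC; apply: np.
  by apply: filterS nC => q nq [].
split=> //; move: (Dl); rewrite closedE; apply=> nD; apply: np.
have n : \forall q \near p, ~ D (f q) by exact: (fc p Cp _ nD).
by apply: filterS n => q nq [].
Qed.

Lemma compact_min {T : topologicalType} (C : set T) (f : T -> R) :
  compact C -> C !=set0 -> (forall p : T, C p -> {for p, continuous f}) ->
  exists2 c, C c & forall p : T, C p -> f c <= f p.
Proof.
move=> Cc C0 fc; have [|c] := @compact_EVT_min _ _ f _ C0 Cc.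
  by apply: continuous_in_subspaceT => x; rewrite inE; exact: fc.
by rewrite inE => Cc' cm; exists c => // x Cx; apply: cm; rewrite inE.
Qed.

End EuclideanBalls.

(** * The strong minimum principle *)

Section StrongMinimumPrinciple.
Context {R : realType} {m : nat}.
Implicit Types (w : 'rV[R]_m -> R) (x y z u nu : 'rV[R]_m).

Definition elliptic_op (G : 'M[R]_m) (b : 'rV[R]_m) w x : R :=
  \sum_i \sum_j G i j * 'D_(delta_mx 0 i) ('D_(delta_mx 0 j) w) x +
  \sum_k b 0 k * 'D_(delta_mx 0 k) w x.

Lemma derive2_coords w x u :
  (\forall y \near x, differentiable w y) ->
  (forall v, differentiable ('D_v w) x) ->
  'D_u ('D_u w) x =
  \sum_i \sum_j u 0 i * u 0 j * 'D_(delta_mx 0 i) ('D_(delta_mx 0 j) w) x.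
Proof.
move=> dw d2w; rewrite derive_coords //; apply: eq_bigr => i _.
have E : \forall y \near x,
    'D_u w y = (\sum_j (u 0 j *: 'D_(delta_mx 0 j) w)) y.
  by apply: filterS dw => y dwy; rewrite derive_coords // fct_sumE.
rewrite (near_eq_derive _ E) derive_sum => [|j].
  rewrite scaler_sumr; apply: eq_bigr => j _; rewrite deriveZ.
    by rewrite scalerA.
  exact: diff_derivable (d2w _).
by apply: derivableZ; exact: diff_derivable (d2w _).
Qed.

Lemma elliptic_op_gram {p} (Q : 'M[R]_(m, p)) b w x :
  (\forall y \near x, differentiable w y) ->
  (forall v, differentiable ('D_v w) x) ->
  elliptic_op (Q *m Q^T) b w x =
  \sum_c 'D_(col c Q)^T ('D_(col c Q)^T w) x + 'D_b w x.
Proof.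
move=> dw d2w; rewrite /elliptic_op; congr (_ + _); last first.
  by rewrite derive_coords //; exact: nbhs_singleton dw.
under [RHS]eq_bigr do rewrite derive2_coords //.
rewrite [RHS]exchange_big; apply: eq_bigr => i _; rewrite [RHS]exchange_big.
apply: eq_bigr => j _; rewrite mxE mulr_suml; apply: eq_bigr => c _.
by rewrite !mxE.
Qed.

(** At a local minimum of [w - v] the gradients of [w] and [v] agree and the
    Hessian of the difference is nonnegative; a coefficient matrix [Q Q^T] sums
    that Hessian over the columns of [Q]. *)
Lemma elliptic_comparison {p} (Q : 'M[R]_(m, p)) b w v x :
  (\forall y \near x, differentiable w y /\ differentiable v y) ->
  (forall u, differentiable ('D_u w) x /\ differentiable ('D_u v) x) ->
  (\forall y \near x, w x - v x <= w y - v y) ->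
  elliptic_op (Q *m Q^T) b v x <= elliptic_op (Q *m Q^T) b w x.
Proof.
move=> dwv d2 min.
have dw : \forall y \near x, differentiable w y by apply: filterS dwv => y [].
have dv : \forall y \near x, differentiable v y by apply: filterS dwv => y [].
have d2w u : differentiable ('D_u w) x by have [] := d2 u.
have d2v u : differentiable ('D_u v) x by have [] := d2 u.
have dB u y : differentiable w y /\ differentiable v y ->
    is_derive y u (w - v) ('D_u w y - 'D_u v y).
  by move=> [a c]; apply: is_deriveB; apply: derivableP; exact: diff_derivable.
have near_dB u : \forall y \near x, derivable (w - v) y u.
  by apply: filterS dwv => y /(dB u) [].
have E u : \forall y \near x, ('D_u w - 'D_u v) y = 'D_u (w - v) y.
  by apply: filterS dwv => y /(dB u) [_ ->].
have dDB u : is_derive x u ('D_u (w - v)) ('D_u ('D_u w) x - 'D_u ('D_u v) x).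
  apply: (@near_eq_is_derive _ _ _ ('D_u w - 'D_u v) ('D_u (w - v)) x u _ (E u)).
  apply: is_deriveB; apply: derivableP.
    exact: diff_derivable (d2w u).
  exact: diff_derivable (d2v u).
rewrite !elliptic_op_gram //; apply: lerD.
  apply: ler_sum => c _; rewrite -subr_ge0.
  have [dd <-] := dDB (col c Q)^T.
  exact: derive2_local_min (near_dB _) dd min.
have := derive_local_min _ _ _ (near_dB b) min.
have [_ ->] := dB b x (nbhs_singleton dwv).
by move/eqP; rewrite subr_eq0 => /eqP ->.
Qed.

(** The barrier for Hopf's argument at a point [z] of the sphere with centre
    [z - nu].  Put [l = 2 (x - z, nu)] and [q = |x - z|^2], so that [l + q < 0]
    is the open ball; the barrier is [- l - 2 q + K l^2].  Close to [z] it is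
    negative off the ball, except at [z], where it vanishes: there the term
    [- 2 q] wins if [l < 0], and [- l] wins over [K l^2] if [l > 0].  For large
    [K] the term [K l^2] makes it a strict subsolution.  Being quadratic, it has
    constant second derivatives. *)
Definition barrier z nu (K : R) x : R :=
  - 2 * dot (x - z) nu - 2 * dot (x - z) (x - z) + 4 * K * dot (x - z) nu ^+ 2.

Lemma differentiable_barrier z nu K x : differentiable (barrier z nu K) x.
Proof.
have dz : differentiable (fun x => x - z) x by exact: differentiableB.
have dl : differentiable (fun x => dot (x - z) nu) x by exact: differentiable_dot.
have dq : differentiable (fun x => dot (x - z) (x - z)) x by exact: differentiable_dot.
rewrite (_ : barrier z nu K = (-2) *: (fun x => dot (x - z) nu)
  - 2 *: (fun x => dot (x - z) (x - z)) + (4 * K) *: (fun x => dot (x - z) nu) ^+ 2);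
  last by apply/funext.
apply: differentiableD; last by apply: differentiableZ; exact: differentiableX.
by apply: differentiableB; exact: differentiableZ.
Qed.

Lemma derive_barrier z nu K u x :
  'D_u (barrier z nu K) x =
  - 2 * dot u nu - 4 * dot (x - z) u + 8 * K * dot (x - z) nu * dot u nu.
Proof.
have dz : is_derive x u (fun x => x - z) u.
  rewrite -[X in is_derive _ _ _ X]subr0.
  exact: (is_deriveB (is_derive_id x u) (is_derive_cst z x u)).
have dl : is_derive x u (fun x => dot (x - z) nu) (dot u nu).
  by apply: is_derive_eq; [exact: is_derive_dot | rewrite dot0r addr0].
have dq : is_derive x u (fun x => dot (x - z) (x - z)) (2 * dot (x - z) u).
  by apply: is_derive_eq; [exact: is_derive_dot | rewrite dotC; ring].
rewrite (_ : barrier z nu K = (-2) *: (fun x => dot (x - z) nu)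
  - 2 *: (fun x => dot (x - z) (x - z)) +
  (4 * K) *: ((fun x => dot (x - z) nu) * (fun x => dot (x - z) nu)));
  last by apply/funext.
have [_ ->] := is_deriveD (is_deriveB (is_deriveZ (-2) dl) (is_deriveZ 2 dq))
  (is_deriveZ (4 * K) (is_deriveM dl dl)).
rewrite /GRing.scale /=; ring.
Qed.

Lemma derive_barrierE z nu K u :
  'D_u (barrier z nu K) =
  cst (- 2 * dot u nu) - 4 *: (fun x => dot (x - z) u) +
  (8 * K * dot u nu) *: (fun x => dot (x - z) nu).
Proof.
apply/funext => y; rewrite derive_barrier.
transitivity (- 2 * dot u nu - 4 * dot (y - z) u +
    8 * K * dot u nu * dot (y - z) nu); [ring | by []].
Qed.

Lemma derive2_barrier z nu K t u x :
  'D_t ('D_u (barrier z nu K)) x = - 4 * dot t u + 8 * K * dot t nu * dot u nu.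
Proof.
rewrite derive_barrierE.
have dz : is_derive x t (fun x => x - z) t.
  rewrite -[X in is_derive _ _ _ X]subr0.
  exact: (is_deriveB (is_derive_id x t) (is_derive_cst z x t)).
have dl a : is_derive x t (fun x => dot (x - z) a) (dot t a).
  by apply: is_derive_eq; [exact: is_derive_dot | rewrite dot0r addr0].
have [_ ->] := is_deriveD
  (is_deriveB (is_derive_cst (-2 * dot u nu) x t) (is_deriveZ 4 (dl u)))
  (is_deriveZ (8 * K * dot u nu) (dl nu)).
rewrite /GRing.scale /=; ring.
Qed.

Lemma differentiable_derive_barrier z nu K u x :
  differentiable ('D_u (barrier z nu K)) x.
Proof.
rewrite derive_barrierE.
have dl a : differentiable (fun x => dot (x - z) a) x.
  by apply: differentiable_dot => //; exact: differentiableB.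
apply: differentiableD; last by apply: differentiableZ.
by apply: differentiableB => //; exact: differentiableZ.
Qed.

Lemma elliptic_opZ (G : 'M[R]_m) b w e x : (forall y, differentiable w y) ->
  (forall u, differentiable ('D_u w) x) ->
  elliptic_op G b (e *: w) x = e * elliptic_op G b w x.
Proof.
move=> dw d2w.
have E u : 'D_u (e *: w) = e *: 'D_u w.
  by apply/funext => y; exact: deriveZ (diff_derivable (dw y)).
rewrite /elliptic_op mulrDr !mulr_sumr; congr (_ + _).
  apply: eq_bigr => i _; rewrite mulr_sumr; apply: eq_bigr => j _.
  by rewrite E (deriveZ _ (diff_derivable (d2w _))) mulrCA.
apply: eq_bigr => k _.
by rewrite (deriveZ _ (diff_derivable (dw x))) mulrCA.
Qed.

Lemma barrier_at_contact z nu K : barrier z nu K z = 0.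
Proof. by rewrite /barrier subrr !dot0l; ring. Qed.

Lemma barrier_lt0 z nu K x : 0 < K -> x != z ->
  K * dot (x - z) (x - z) < 1 -> K * (2 * dot (x - z) nu) < 1 ->
  0 <= 2 * dot (x - z) nu + dot (x - z) (x - z) -> barrier z nu K x < 0.
Proof.
move=> K0; rewrite -subr_eq0 => /dot_gt0; rewrite /barrier.
move: (dot _ nu) (dot _ _) => l q q0 Kq Kl lq.
rewrite (_ : _ + _ = - 2 * l - 2 * q + K * (2 * l) ^+ 2); last by ring.
have [l0|l0] := lerP 0 l; first by nra.
have lq2 : 0 <= (q - 2 * l) * (q + 2 * l) by apply: mulr_ge0; lra.
have Kq2 : 0 <= (1 - K * q) * q by apply: mulr_ge0; lra.
have := mulr_ge0 (ltW K0) lq2; rewrite expr2; nra.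
Qed.

Lemma elliptic_barrier (G : 'M[R]_m) b z nu K x :
  elliptic_op G b (barrier z nu K) x =
  \sum_i \sum_j G i j * (- 4 * dot (delta_mx 0 i) (delta_mx 0 j : 'rV_m)
      + 8 * K * dot (delta_mx 0 i) nu * dot (delta_mx 0 j) nu) +
  \sum_k b 0 k * (- 2 * dot (delta_mx 0 k) nu - 4 * dot (x - z) (delta_mx 0 k)
      + 8 * K * dot (x - z) nu * dot (delta_mx 0 k) nu).
Proof.
rewrite /elliptic_op; congr (_ + _).
  apply: eq_bigr => i _; apply: eq_bigr => j _; congr (_ * _).
  exact: derive2_barrier.
by apply: eq_bigr => k _; congr (_ * _); exact: derive_barrier.
Qed.

Lemma continuous_elliptic_barrier (G : 'rV[R]_m -> 'M[R]_m)
    (b : 'rV[R]_m -> 'rV[R]_m) z nu K :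
  {for z, continuous G} -> {for z, continuous b} ->
  {for z, continuous (fun x => elliptic_op (G x) (b x) (barrier z nu K) x)}.
Proof.
move=> cG cb.
rewrite (_ : (fun x => _) = (fun x =>
  \sum_i \sum_j G x i j * (- 4 * dot (delta_mx 0 i) (delta_mx 0 j : 'rV_m)
      + 8 * K * dot (delta_mx 0 i) nu * dot (delta_mx 0 j) nu) +
  \sum_k b x 0 k * (- 2 * dot (delta_mx 0 k) nu - 4 * dot (x - z) (delta_mx 0 k)
      + 8 * K * dot (x - z) nu * dot (delta_mx 0 k) nu))); last first.
  by apply/funext => x; rewrite elliptic_barrier.
apply: continuous_at_add.
  apply: continuous_at_sum => i; apply: continuous_at_sum => j.
  by apply: continuous_at_mul; [exact: continuous_at_entry | exact: continuous_at_cst].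
apply: continuous_at_sum => k.
apply: continuous_at_mul; first exact: continuous_at_entry.
apply: continuous_at_add.
  apply: continuous_at_sub; first exact: continuous_at_cst.
  apply: continuous_at_mul; first exact: continuous_at_cst.
  exact: continuous_at_dot_sub.
apply: continuous_at_mul; last exact: continuous_at_cst.
apply: continuous_at_mul; first exact: continuous_at_cst.
exact: continuous_at_dot_sub.
Qed.

(** At [z] the operator sends the barrier to [A + 8 K (nu G nu^T)] for some [A]
    independent of [K]; positivity at [z] spreads by continuity of the
    coefficients. *)
Lemma exists_barrier (G : 'rV[R]_m -> 'M[R]_m) (b : 'rV[R]_m -> 'rV[R]_m) z nu :
  {for z, continuous G} -> {for z, continuous b} ->
  0 < (nu *m G z *m nu^T) 0 0 ->
  exists2 K : R, 0 < K &
    \forall x \near z, 0 < elliptic_op (G x) (b x) (barrier z nu K) x.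
Proof.
move=> cG cb; set P : R := (_ *m _) 0 0 => P0.
have [A EA] : exists A : R, forall K : R,
    elliptic_op (G z) (b z) (barrier z nu K) z = A + K * (8 * P).
  exists (\sum_i \sum_j G z i j * (- 4 * dot (delta_mx 0 i) (delta_mx 0 j : 'rV_m)) +
          \sum_k b z 0 k * (- 2 * dot (delta_mx 0 k) nu)) => K.
  have -> : P = \sum_i \sum_j nu 0 i * G z i j * nu 0 j.
    rewrite /P mxE exchange_big; apply: eq_bigr => j _.
    by rewrite !mxE mulr_suml.
  rewrite elliptic_barrier addrAC; congr (_ + _); last first.
    by apply: eq_bigr => k _; rewrite subrr !dot0l; ring.
  rewrite mulr_sumr mulr_sumr -big_split; apply: eq_bigr => i _ /=.
  rewrite [X in _ = _ + X]mulrA [X in _ = _ + X]mulr_sumr -big_split.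
  apply: eq_bigr => j _ /=.
  by rewrite !(dotC _ nu) !(dot_delta nu); ring.
exists ((`|A| + 1) / (8 * P)); first by rewrite divr_gt0 ?ltr_wpDl ?mulr_gt0.
apply: (cvgr_gt _ (continuous_elliptic_barrier G b z nu _ cG cb)).
rewrite EA divfK ?gt_eqF ?mulr_gt0 //.
by have := ler_norm (- A); rewrite normrN; lra.
Qed.

Definition twice_differentiable (U : set 'rV[R]_m) w :=
  forall x, U x -> differentiable w x /\ forall u, differentiable ('D_u w) x.

(** Positive definiteness, in the form in which the Hessian at a minimum is
    estimated and in which the inverse of a Gram matrix is given. *)
Definition gram_coefficient (G : 'M[R]_m) :=
  G \in unitmx /\ exists p (Q : 'M[R]_(m, p)), G = Q *m Q^T.

Lemma gram_coefficient_pos (G : 'M[R]_m) nu : gram_coefficient G -> nu != 0 ->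
  0 < (nu *m G *m nu^T) 0 0.
Proof.
move=> [Gu [p [Q E]]] nu0.
have -> : (nu *m G *m nu^T) 0 0 = dot (nu *m Q) (nu *m Q).
  by rewrite dot_mulmx E trmx_mul !mulmxA.
apply: dot_gt0; apply: contra_neq nu0 => nuQ.
by rewrite -(mulmxK Gu nu) E mulmxA nuQ !mul0mx.
Qed.

(** Hopf's lemma.  If [w > w z] inside a ball that has [z] on its boundary, then
    on the boundary of a small ball around [z] the function [w - e barrier]
    exceeds its value [w z] at [z]: where the barrier is nonnegative [w] exceeds
    [w z] by a definite amount, elsewhere the barrier is negative.  So it has an
    interior minimum, where the operator cannot be positive on the barrier and
    nonpositive on [w]. *)
Lemma hopf_contact (U : set 'rV[R]_m) (G : 'rV[R]_m -> 'M[R]_m)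
    (b : 'rV[R]_m -> 'rV[R]_m) w z nu :
  open U -> U z -> twice_differentiable U w ->
  (forall x, U x -> gram_coefficient (G x)) ->
  {for z, continuous G} -> {for z, continuous b} ->
  (forall x, U x -> elliptic_op (G x) (b x) w x <= 0) ->
  (forall x, U x -> w z <= w x) ->
  (forall x, U x -> 2 * dot (x - z) nu + dot (x - z) (x - z) < 0 -> w z < w x) ->
  nu = 0.
Proof.
move=> oU Uz dw gG cG cb Lw wz touch; apply: contrapT => /eqP nu0.
have [K K0 nL] := exists_barrier G b z nu cG cb
  (gram_coefficient_pos _ _ (gG z Uz) nu0).
pose bar := barrier z nu K.
have cbar x : {for x, continuous bar}.
  exact: differentiable_continuous (differentiable_barrier z nu K x).
have nU : \forall x \near z, U x by exact: open_nbhs_nbhs.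
have nb : \forall x \near z, bar x < 1.
  by apply: (cvgr_lt _ (cbar z)); rewrite /bar barrier_at_contact.
have nq : \forall x \near z, dot (x - z) (x - z) < K^-1.
  by apply: dot_ball_near; rewrite invr_gt0.
have nl : \forall x \near z, 2 * dot (x - z) nu < K^-1.
  apply: (cvgr_lt _ (continuous_at_mul _ _ z (continuous_at_cst 2 z)
    (continuous_at_dot_sub z nu z))).
  by rewrite subrr dot0l mulr0 invr_gt0.
have [d d0 H] := near_dot_ball z _
  (filterI (filterI nU nL) (filterI nb (filterI nq nl))).
pose D := [set x : 'rV[R]_m | dot (x - z) (x - z) <= d].
have Dc : compact D by exact: dot_ball_compact.
have Dl : closed D by exact: dot_ball_closed.
have DU x : D x -> U x by move=> /H[[]].
have wbar x : D x -> x != z -> 0 <= bar x -> w z < w x.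
  move=> Dx xz b0; have [[Ux _] [_ [qK lK]]] := H x Dx.
  apply: touch => //; rewrite ltNge; apply/negP => ge0.
  suff : bar x < 0 by rewrite ltNge b0.
  by apply: barrier_lt0; rewrite // mulrC -ltr_pdivlMr ?mul1r.
have cw x : D x -> {for x, continuous w}.
  by move=> /DU /dw [dwx _]; exact: differentiable_continuous.
have [e e0 eS] : exists2 e : R, 0 < e &
    forall x, dot (x - z) (x - z) = d -> 0 <= bar x -> w z + e < w x.
  pose S := [set x | [set x | D x /\ [set r : R | r = d] (dot (x - z) (x - z))] x /\
                     [set r : R | 0 <= r] (bar x)].
  have cS1 : compact [set x | D x /\ [set r : R | r = d] (dot (x - z) (x - z))].
    apply: (compact_constraint D _ [set r : R | r = d] Dc Dl _ (@closed_eq R d)).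
    by move=> x _; exact: dot_sub_continuous.
  have lS1 : closed [set x | D x /\ [set r : R | r = d] (dot (x - z) (x - z))].
    by apply: compact_closed cS1; exact: norm_hausdorff.
  have cS : compact S.
    apply: (compact_constraint _ bar [set r : R | 0 <= r] cS1 lS1 _ (@closed_ge R 0)).
    by move=> x _; exact: cbar.
  have [S0|S0] := pselect (S !=set0); last first.
    exists 1 => // x xd b0; exfalso; apply: S0; exists x; split=> //.
    by split=> //; rewrite /D /= xd.
  have cwS x : S x -> {for x, continuous w} by move=> [[/cw]].
  have [s [[Ds sd] sb] smin] := compact_min S w cS S0 cwS.
  have sz : s != z.
    by apply: contraTneq d0 => sz; rewrite -(sd : _ = d) sz subrr dot0l ltxx.
  have ws := wbar s Ds sz sb.
  exists ((w s - w z) / 2) => [|x xd b0]; first by rewrite divr_gt0 ?subr_gt0.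
  have : w s <= w x by apply: smin; split=> //; split; rewrite /D /= xd.
  by move: ws; lra.
pose phi x := w x - e * bar x.
have cphi x : D x -> {for x, continuous phi}.
  move=> Dx; apply: continuous_at_sub; first exact: cw.
  by apply: continuous_at_mul; [exact: continuous_at_cst | exact: cbar].
have Dz : D z by rewrite /D /= subrr dot0l ltW.
have [p Dp pmin] := compact_min D phi Dc (ex_intro _ z Dz) cphi.
have pz : phi p <= w z.
  by have := pmin z Dz; rewrite /phi /bar barrier_at_contact mulr0 subr0.
have [[Up Lp] [b1 _]] := H p Dp.
have pd : dot (p - z) (p - z) < d.
  rewrite lt_neqAle [X in _ && X]Dp andbT; apply/eqP => pd.
  have [b0|b0] := lerP 0 (bar p).
    have := eS p pd b0; move: pz; rewrite /phi => pz; nra.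
  by have := wz p Up; move: pz; rewrite /phi => pz; nra.
have nD : \forall x \near p, D x.
  have n : \forall x \near p, dot (x - z) (x - z) < d.
    exact: (cvgr_lt _ (dot_sub_continuous z p) _ pd).
  by apply: filterS n => x /ltW.
have pU : \forall x \near p, U x by exact: open_nbhs_nbhs.
have [Gu [k [Q GE]]] := gG p Up.
have db x : differentiable bar x by exact: differentiable_barrier.
have d2b u x : differentiable ('D_u bar) x by exact: differentiable_derive_barrier.
suff : e * elliptic_op (G p) (b p) bar p <= elliptic_op (G p) (b p) w p.
  have := Lw p Up; have : 0 < e * elliptic_op (G p) (b p) bar p by rewrite mulr_gt0.
  lra.
rewrite -elliptic_opZ // GE; apply: elliptic_comparison.
- by apply: filterS pU => x /dw [dwx _]; split=> //; exact: differentiableZ.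
- move=> u; split; first exact: (dw p Up).2.
  rewrite (_ : 'D_u (e *: bar) = e *: 'D_u bar); first exact: differentiableZ.
  by apply/funext => y; exact: deriveZ (diff_derivable (db y)).
- by apply: filterS nD => x; exact: pmin.
Qed.

(** If [w y > w x0] for some [y] close to [x0], grow a ball around [y] until it
    first touches the set [w = w x0], at [z] say; this contact contradicts
    [hopf_contact]. *)
Theorem strong_minimum_principle (U : set 'rV[R]_m) (G : 'rV[R]_m -> 'M[R]_m)
    (b : 'rV[R]_m -> 'rV[R]_m) w x0 :
  open U -> U x0 -> twice_differentiable U w ->
  (forall x, U x -> gram_coefficient (G x)) ->
  (forall x, U x -> {for x, continuous G}) ->
  (forall x, U x -> {for x, continuous b}) ->
  (forall x, U x -> elliptic_op (G x) (b x) w x <= 0) ->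
  (forall x, U x -> w x0 <= w x) ->
  \forall x \near x0, w x = w x0.
Proof.
move=> oU Ux0 dw gG cG cb Lw wmin.
(* The radius r / 4 for y keeps the ball of the first contact inside the ball
   of radius r, by dotD_le. *)
have [r r0 CU] := near_dot_ball x0 U (open_nbhs_nbhs (conj oU Ux0)).
have r4 : 0 < r / 4 by rewrite divr_gt0.
have dC x y : dot (x - y) (x - y) < r / 4 -> dot (y - x0) (y - x0) < r / 4 ->
    dot (x - x0) (x - x0) < r.
  move=> xy yx; have := dotD_le (x - y) (y - x0); rewrite subrKA; lra.
apply: filterS (dot_ball_near x0 _ r4) => y yx0.
have Uy : U y by apply: CU; move: yx0 r0; lra.
pose C := [set x : 'rV[R]_m | dot (x - x0) (x - x0) <= r].
have cw x : C x -> {for x, continuous w}.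
  by move=> /CU /dw [dwx _]; exact: differentiable_continuous.
have cZ := compact_constraint C w [set t : R | t = w x0] (dot_ball_compact x0 r)
  (dot_ball_closed x0 r) cw (@closed_eq R (w x0)).
have Z0 : C x0 /\ [set t : R | t = w x0] (w x0).
  by split=> //; rewrite /C /= subrr dot0l ltW.
have [z [Cz wz] zmin] := compact_min _ (fun x => dot (x - y) (x - y)) cZ
  (ex_intro _ x0 Z0) (fun x _ => dot_sub_continuous y x).
have zy : dot (z - y) (z - y) < r / 4.
  by apply: le_lt_trans (zmin x0 Z0) _; rewrite -opprB dotNl dotNr opprK.
suff zy0 : z - y = 0 by move: zy0 wz => /eqP; rewrite subr_eq0 => /eqP ->.
have Uz := CU z Cz.
apply: (hopf_contact U G b w z _ oU Uz dw gG (cG z Uz) (cb z Uz) Lw).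
  by move=> x Ux; rewrite wz; exact: wmin.
move=> x Ux xz.
have xy : dot (x - y) (x - y) < dot (z - y) (z - y).
  have -> : x - y = (x - z) + (z - y) by rewrite subrKA.
  move: (x - z) (z - y) xz => a c ac; rewrite dotDl !dotDr (dotC c a); lra.
rewrite wz lt_neqAle wmin // andbT; apply/eqP => E.
have Cx : C x by apply/ltW/(dC _ y) => //; exact: lt_trans zy.
by have := zmin x (conj Cx (esym E)); rewrite leNgt xy.
Qed.

End StrongMinimumPrinciple.

(** * Smooth maps and matrix-valued functions *)

Section NearDifferentiable.
Context {R : realType} {V W : normedModType R}.

Lemma differentiable_near0 (h : V -> W) x :
  (\forall y \near x, h y = 0) -> differentiable h x.
Proof.
move=> h0.
have h0' : \forall y \near (0 : V), h (y + x) = 0.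
  by move: h0; rewrite (near_shift 0) subr0.
have D : h \o shift x = cst (h x) + (\0 : V -> W) +o_ 0 id.
  apply/eqaddoP => _/posnumP[e]; near=> y.
  have hy : h (y + x) = 0.
    by near: y; exact: h0'.
  rewrite [X in `|X|](_ : _ = 0) ?normr0 ?mulr_ge0 //.
  rewrite (_ : (_ - _) y = h (y + x) - (h x + 0)) // hy (nbhs_singleton h0).
  by rewrite addr0 subrr.
have c0 : continuous (\0 : V -> W) by exact: cst_continuous.
by apply/diff_locallyP; rewrite (diff_unique c0 D).
Unshelve. all: by end_near. Qed.

Lemma near_eq_differentiable (f g : V -> W) x :
  (\forall y \near x, f y = g y) -> differentiable f x -> differentiable g x.
Proof.
move=> fg df; rewrite (_ : g = f + (g - f)); last first.
  by apply/funext => y; rewrite addrC subrK.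
apply: differentiableD => //; apply: differentiable_near0.
by apply: filterS fg => y e; rewrite (_ : (g - f) y = g y - f y) // e subrr.
Qed.

End NearDifferentiable.

Section SmoothMaps.
Context {R : realType} {m k : nat}.
Implicit Types (U : set 'rV[R]_m) (F : 'rV[R]_m -> 'rV[R]_k) (x v : 'rV[R]_m).

Lemma smooth_on_differentiable {U F x} : smooth_on U F -> U x -> differentiable F x.
Proof. by move=> sF Ux; have [dF _] := sF 1%N; exact: dF. Qed.

Lemma smooth_on_derive {U F} v : smooth_on U F -> smooth_on U ('D_v F).
Proof. by move=> sF n; have [_ dF] := sF n.+1; exact: dF. Qed.

Lemma smooth_on_derivable {U F x} v : smooth_on U F -> U x -> derivable F x v.
Proof. by move=> sF Ux; apply: diff_derivable; exact: smooth_on_differentiable sF Ux. Qed.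

Lemma smooth_on_continuous {U F x} : smooth_on U F -> U x -> {for x, continuous F}.
Proof.
by move=> sF Ux; apply: differentiable_continuous; exact: smooth_on_differentiable sF Ux.
Qed.

Lemma derive_cst_on {U} (f : 'rV[R]_m -> R) c x v :
  open U -> U x -> (forall y, U y -> f y = c) -> 'D_v f x = 0.
Proof.
move=> oU Ux fc; rewrite -(derive_cst c x v); apply: near_eq_derive.
by apply: filterS (open_nbhs_nbhs (conj oU Ux)) => y /fc.
Qed.

Lemma derive_eq_on {U} (f g : 'rV[R]_m -> R) x v :
  open U -> U x -> (forall y, U y -> f y = g y) -> 'D_v f x = 'D_v g x.
Proof.
move=> oU Ux fg; apply: near_eq_derive.
by apply: filterS (open_nbhs_nbhs (conj oU Ux)) => y /fg.
Qed.

Lemma derive_dot_cst {U F} {H : 'rV[R]_m -> 'rV[R]_k} {c x} v :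
  open U -> U x -> smooth_on U F -> smooth_on U H ->
  (forall y, U y -> dot (F y) (H y) = c) ->
  dot ('D_v F x) (H x) + dot (F x) ('D_v H x) = 0.
Proof.
move=> oU Ux sF sH FH; rewrite -(derive_cst_on _ _ _ v oU Ux FH) derive_dot //.
  exact: smooth_on_derivable sF Ux.
exact: smooth_on_derivable sH Ux.
Qed.

Lemma smooth_on_derive_comm {U F} v w x : open U -> U x -> smooth_on U F ->
  'D_w ('D_v F) x = 'D_v ('D_w F) x.
Proof.
move=> oU Ux sF; apply/rowP => i.
have nU : \forall y \near x, U y by exact: open_nbhs_nbhs.
have sD u := smooth_on_derive u sF.
have E u t y : U y -> 'D_t ('D_u F) y 0 i = 'D_t ('D_u (fun y => F y 0 i)) y.
  move=> Uy; rewrite -derive_coord; last exact: smooth_on_derivable (sD u) Uy.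
  apply: (derive_eq_on _ _ _ _ oU Uy) => z Uz.
  by rewrite derive_coord //; exact: smooth_on_derivable sF Uz.
have near_E u : \forall y \near x, 'D_u (fun y => F y 0 i) y = 'D_u F y 0 i.
  apply: filterS nU => y Uy; rewrite derive_coord //.
  exact: smooth_on_derivable sF Uy.
have d1 u : \forall y \near x, derivable (fun y => F y 0 i) y u.
  apply: filterS nU => y Uy; apply: derivable_coord.
  exact: smooth_on_derivable sF Uy.
have d2 u t : \forall y \near x, derivable ('D_u (fun y => F y 0 i)) y t.
  apply: filterS nU => y Uy.
  apply: (@near_eq_derivable _ _ _ (fun y => 'D_u F y 0 i)).
    apply: filterS (open_nbhs_nbhs (conj oU Uy)) => z Uz.
    by rewrite derive_coord //; exact: smooth_on_derivable sF Uz.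
  by apply: derivable_coord; exact: smooth_on_derivable (sD u) Uy.
have c u t : {for x, continuous ('D_t ('D_u (fun y => F y 0 i)))}.
  have cDD : {for x, continuous (fun y => 'D_t ('D_u F) y 0 i)}.
    apply: continuous_at_entry.
    exact: smooth_on_continuous (smooth_on_derive t (sD u)) Ux.
  apply: continuous_at_near_eq cDD.
  by apply: filterS nU => y Uy; exact: E.
apply: (etrans (E v w x Ux)); apply: (etrans _ (esym (E w v x Ux))).
exact: (derive_comm _ _ _ _ (filterI (d1 v) (d1 w)) (filterI (d2 v w) (d2 w v))
          (c v w) (c w v)).
Qed.

End SmoothMaps.

Section MatrixCalculus.
Context {R : realType} {V : normedModType R}.
Implicit Types (x v : V).

Lemma differentiable_det {n} (A : V -> 'M[R]_n) x :
  (forall i j, differentiable (fun y => A y i j) x) ->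
  differentiable (fun y => \det (A y)) x.
Proof.
move=> dA; rewrite /determinant; apply: differentiable_bigsum => s.
rewrite (_ : (fun y => _) = (-1) ^+ s *: (fun y => \prod_i A y i (s i))) //.
by apply: differentiableZ; apply: differentiable_bigprod => i; exact: dA.
Qed.

Lemma differentiable_adj {n} (A : V -> 'M[R]_n) x i j :
  (forall i j, differentiable (fun y => A y i j) x) ->
  differentiable (fun y => (\adj (A y)) i j) x.
Proof.
move=> dA; rewrite (_ : (fun y => _) =
  (-1) ^+ (j + i) *: (fun y => \det (row' j (col' i (A y))))); last first.
  by apply/funext => y; rewrite mxE.
apply: differentiableZ; apply: differentiable_det => a b.
rewrite (_ : (fun y => _) = (fun y => A y (lift j a) (lift i b))); first exact: dA.
by apply/funext => y; rewrite !mxE.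
Qed.

Lemma continuous_at_mx {T : topologicalType} {p q} (H : T -> 'M[R]_(p, q)) (t : T) :
  (forall i j, {for t, continuous (fun y => H y i j)}) -> {for t, continuous H}.
Proof.
move=> cH; apply/cvgrPdist_le => /= e e0.
near=> s.
rewrite [leLHS]/Num.Def.normr/= mx_normrE (bigmax_le _ (ltW e0))//= => i _.
rewrite !mxE /=; move: i; near: s; apply: filter_forall => /= i.
exact: (cvgrPdist_le _ _).1 (cH i.1 i.2) e e0.
Unshelve. all: by end_near. Qed.

Lemma differentiable_derivable_mx {p q} (A : V -> 'M[R]_(p, q)) x v :
  (forall i j, differentiable (fun y => A y i j) x) -> derivable A x v.
Proof. by move=> dA; apply/derivable_mxP => i j; apply: diff_derivable; exact: dA. Qed.

Lemma derive_mulmx {p q r} (A : V -> 'M[R]_(p, q)) (B : V -> 'M[R]_(q, r)) x v :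
  derivable A x v -> derivable B x v ->
  is_derive x v (fun y => A y *m B y) ('D_v A x *m B x + A x *m 'D_v B x).
Proof.
move=> dA dB.
have D i k : is_derive x v (fun y => (A y *m B y) i k)
    (('D_v A x *m B x + A x *m 'D_v B x) i k).
  rewrite (_ : (fun y => _) = \sum_j ((fun y => A y i j) * (fun y => B y j k))); last first.
    by apply/funext => y; rewrite mxE fct_sumE.
  rewrite !mxE -big_split /=.
  rewrite (eq_bigr (fun j => A x i j *: 'D_v (fun y => B y j k) x +
                             B x j k *: 'D_v (fun y => A y i j) x)); last first.
    move=> j _; rewrite (derive_coord A x v i j dA) (derive_coord B x v j k dB) addrC.
    by congr (_ + _); exact: mulrC.
  by apply: is_derive_sum => j; apply: is_deriveM; apply: derivableP;
    exact: derivable_coord.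
have dAB : derivable (fun y => A y *m B y) x v.
  by apply/derivable_mxP => i k; have [] := D i k.
split=> //; apply/matrixP => i k; rewrite derive_mx // mxE.
by have [_ ->] := D i k.
Qed.

Lemma derive_trace {p} (A : V -> 'M[R]_p) x v :
  derivable A x v -> 'D_v (fun y => \tr (A y)) x = \tr ('D_v A x).
Proof.
move=> dA; rewrite (_ : (fun y => _) = \sum_i (fun y => A y i i)); last first.
  by apply/funext => y; rewrite fct_sumE.
rewrite derive_sum => [|i]; last exact: derivable_coord.
by apply: eq_bigr => i _; rewrite derive_coord.
Qed.

End MatrixCalculus.

(** * The linear algebra of the Gauss map *)

Section FrameAlgebra.
Context {R : realType} {m : nat}.

Lemma mulmx_tr_dot {k p q} (A : 'M[R]_(p, k)) (B : 'M[R]_(q, k)) i j :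
  (A *m B^T) i j = dot (row i A) (row j B).
Proof. by rewrite mxE; apply: eq_bigr => c _; rewrite !mxE. Qed.

Lemma mulmx_tr_row {k} (a b : 'rV[R]_k) : a *m b^T = (dot a b)%:M.
Proof. by apply/rowP => i; rewrite ord1 dot_mulmx [RHS]mxE mulr1n. Qed.

Lemma mulmx_tr_eq0 {k p q} (A : 'M[R]_(p, k)) (B : 'M[R]_(q, k)) :
  A *m B^T = 0 -> B *m A^T = 0.
Proof. by move=> AB; apply: trmx_inj; rewrite trmx_mul trmxK AB trmx0. Qed.

Lemma sum_contract (G A : 'M[R]_m) : G^T = G ->
  \sum_i \sum_j G i j * A i j = \tr (G *m A).
Proof.
move=> Gs; rewrite exchange_big; apply: eq_bigr => j _; rewrite mxE.
by apply: eq_bigr => i _; rewrite -{1}Gs mxE.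
Qed.

Lemma mxtrace_gram_ge0 {p q} (A : 'M[R]_(p, q)) : 0 <= \tr (A *m A^T).
Proof. by apply: sumr_ge0 => i _; rewrite mulmx_tr_dot dot_ge0. Qed.

(** Two orthonormal vectors together with [m] independent vectors orthogonal to
    them span a space of dimension [m + 2]. *)
Lemma orthogonal_frame_eq0 (u n X : 'rV[R]_m.+2) (J : 'M[R]_(m, m.+2)) :
  dot u u = 1 -> dot n n = 1 -> dot n u = 0 ->
  u *m J^T = 0 -> n *m J^T = 0 -> row_free J ->
  dot X u = 0 -> dot X n = 0 -> X *m J^T = 0 -> X = 0.
Proof.
move=> uu nn nu uJ nJ Jf Xu Xn XJ.
pose B : 'M[R]_(m.+2) := col_mx u (col_mx n J).
have Bf : row_free B.
  suff inj (v : 'rV[R]_(1 + (1 + m))) : v *m col_mx u (col_mx n J) = 0 -> v = 0.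
    by apply: inj_row_free => v; exact: inj.
  rewrite -[v]hsubmxK; move: (lsubmx v) (rsubmx v) => a v'.
  rewrite -[v']hsubmxK; move: (lsubmx v') (rsubmx v') => b c.
  rewrite mul_row_col mul_row_col => vB.
  have ab w : a *m (u *m w) + (b *m (n *m w) + c *m (J *m w)) = 0 :> 'rV_1.
    by rewrite !mulmxA -!mulmxDl vB mul0mx.
  have a0 : a = 0.
    have := ab u^T; rewrite !mulmx_tr_row uu nu (mulmx_tr_eq0 _ _ uJ).
    by rewrite !mulmx0 mulmx1 mul_mx_scalar scale0r !addr0.
  have b0 : b = 0.
    have := ab n^T; rewrite !mulmx_tr_row nn (mulmx_tr_eq0 _ _ nJ) a0.
    by rewrite mul0mx mulmx0 mulmx1 addr0 add0r.
  have c0 : c = 0.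
    apply: (row_free_inj Jf); rewrite mul0mx.
    by move: vB; rewrite a0 b0 !mul0mx !add0r.
  by rewrite a0 b0 c0 !row_mx0.
have XB : X *m (col_mx u (col_mx n J))^T = 0.
  rewrite tr_col_mx tr_col_mx mul_mx_row mul_mx_row !mulmx_tr_row Xu Xn XJ.
  by rewrite -scalemx1 !scale0r !row_mx0.
have Bu : B^T \in unitmx by rewrite unitmx_tr -row_free_unit.
by rewrite -(mulmxK Bu X) (XB : X *m B^T = 0) mul0mx.
Qed.

End FrameAlgebra.

(** The data of a hypersurface at one point of a chart, without derivatives: the
    position [u], the unit normal [n], the rows [J] and [DN] of their first
    partial derivatives, the rows [F2 i] and [N2 i] of the [i]-th partial
    derivatives of those rows, the inverse [G] of the first fundamental form, the
    second fundamental form [h], and the partial derivatives [DG], [Dh] of [G]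
    and [h]. *)
Section GaussMapAlgebra.
Context {R : realType} {m : nat}.
Context (u n : 'rV[R]_m.+2) (J DN : 'M[R]_(m, m.+2)).
Context (F2 N2 : 'I_m -> 'M[R]_(m, m.+2)).
Context (G h : 'M[R]_m) (DG Dh : 'I_m -> 'M[R]_m).
Let C l := F2 l *m J^T.
Context (uu : dot u u = 1) (nn : dot n n = 1) (nu : dot n u = 0).
Context (uJ : u *m J^T = 0) (nJ : n *m J^T = 0).
Context (uDN : u *m DN^T = 0) (nDN : n *m DN^T = 0).
Context (Gg : G *m (J *m J^T) = 1%:M) (Gs : G^T = G).
Context (DNJ : DN *m J^T = - h) (hs : h^T = h).

Lemma tangent_expansion {p} (X : 'M[R]_(p, m.+2)) :
  X *m u^T = 0 -> X *m n^T = 0 -> X = X *m J^T *m G *m J.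
Proof.
move=> Xu Xn; have Jf : row_free J.
  by apply/row_freeP; exists (J^T *m G); rewrite mulmxA; exact: mulmx1C.
have Ju := mulmx_tr_eq0 _ _ uJ; have Jn := mulmx_tr_eq0 _ _ nJ.
apply/eqP; rewrite -subr_eq0; apply/eqP; apply/row_matrixP => i; rewrite row0.
apply: (orthogonal_frame_eq0 u n _ J uu nn nu uJ nJ Jf).
- by rewrite dot_mulmx -row_mul mulmxBl Xu -!mulmxA Ju !mulmx0 subrr !mxE.
- by rewrite dot_mulmx -row_mul mulmxBl Xn -!mulmxA Jn !mulmx0 subrr !mxE.
- by rewrite -row_mul mulmxBl -!mulmxA Gg mulmx1 subrr row0.
Qed.

Lemma weingarten : DN = - (h *m G *m J).
Proof.
have DNu := mulmx_tr_eq0 _ _ uDN; have DNn := mulmx_tr_eq0 _ _ nDN.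
by rewrite [LHS]tangent_expansion // DNJ !mulNmx.
Qed.

Context (trGh : \tr (G *m h) = 0).
Context (DGE : forall l, DG l = - (G *m (C l + (C l)^T) *m G)).
Context (trD : forall l, \tr (DG l *m h) + \tr (G *m Dh l) = 0).
Context (N2J : forall i j l, dot (row j (N2 i)) (row l J) =
   - Dh l i j + dot (row j (F2 i)) (row l DN) - dot (row j (F2 l)) (row i DN)
   - dot (row i (F2 l)) (row j DN)).
Context (N2u : forall i j, dot (row j (N2 i)) u = h i j).
Context (N2n : forall i j, dot (row j (N2 i)) n = - dot (row j DN) (row i DN)).

(** Both sides have the same scalar products with the frame [u], [n], [J].
    With [u] this is minimality, with [n] the definition of the energy.  Along
    the tangent vector [l], the Codazzi equation [N2J] is contracted with [G]:
    differentiating [tr (G h) = 0] and inserting the derivative of [G] turns the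
    term with [Dh l] into [2 tr (G C_l G h)], which cancels the two terms with
    [F2 l] by the Weingarten equation.  There remains the scalar product of the
    [l]-th row of [DN] with [\sum_ij G i j F_ij], which is also what the
    first-order term on the right contributes. *)
Lemma gauss_map_laplacian_algebra :
  \sum_i \sum_j G i j *: row j (N2 i) =
  (\sum_i \sum_j G i j *: row j (F2 i)) *m J^T *m G *m DN
  - \tr (G *m (DN *m DN^T)) *: n.
Proof.
set T := \sum_i \sum_j _ *: row j (F2 _); set E := \tr _; set S := LHS.
have Jf : row_free J.
  by apply/row_freeP; exists (J^T *m G); rewrite mulmxA; exact: mulmx1C.
have dS (H : 'I_m -> 'M[R]_(m, m.+2)) v :
    dot (\sum_i \sum_j G i j *: row j (H i)) v =
    \sum_i \sum_j G i j * dot (row j (H i)) v.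
  rewrite dot_suml; apply: eq_bigr => i _; rewrite dot_suml; apply: eq_bigr => j _.
  by rewrite dotZl.
apply/eqP; rewrite -subr_eq0 opprB addrA; apply/eqP.
have tau (c : 'M[R]_m) : \tr (G *m c *m G *m h) = \tr (G *m h *m G *m c^T).
  rewrite -[RHS]mxtrace_tr !trmx_mul trmxK Gs hs.
  by rewrite !mulmxA [RHS]mxtrace_mulC !mulmxA.
have trDh l : \tr (G *m Dh l) = 2 * \tr (G *m h *m G *m (C l)^T).
  have := trD l; rewrite DGE; move: (C l) => c; rewrite mulNmx linearN /= => /eqP.
  rewrite addrC subr_eq0 => /eqP ->; rewrite mulmxDr !mulmxDl linearD /= !tau trmxK.
  rewrite -[X in _ + X]mxtrace_tr !trmx_mul Gs hs.
  by rewrite mxtrace_mulC !mulmxA; ring.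
have DF l : DN *m (F2 l)^T = - (h *m G *m (C l)^T).
  by rewrite /C trmx_mul trmxK mulmxA {1}weingarten mulNmx.
have SJ l : dot S (row l J) = dot T (row l DN).
  rewrite !dS.
  transitivity (\sum_i \sum_j G i j * (- Dh l i j) +
     \sum_i \sum_j G i j * dot (row j (F2 i)) (row l DN) -
     \sum_i \sum_j G i j * (DN *m (F2 l)^T) i j -
     \sum_i \sum_j G i j * (F2 l *m DN^T) i j).
    rewrite -big_split -!sumrB; apply: eq_bigr => i _ /=.
    rewrite -big_split -!sumrB; apply: eq_bigr => j _ /=.
    by rewrite N2J !mulmx_tr_dot [dot (row j (F2 l)) _]dotC; ring.
  rewrite (sum_contract G (DN *m _)) // (sum_contract G (F2 l *m _)) //.
  have -> : \sum_i \sum_j G i j * (- Dh l i j) = - \tr (G *m Dh l).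
    rewrite -sum_contract // -sumrN; apply: eq_bigr => i _.
    by rewrite -sumrN; apply: eq_bigr => j _; rewrite mulrN.
  have -> : \tr (G *m (F2 l *m DN^T)) = \tr (G *m (DN *m (F2 l)^T)).
    by rewrite -mxtrace_tr !trmx_mul trmxK Gs mxtrace_mulC.
  rewrite trDh DF mulmxN linearN /= !mulmxA; ring.
have DNu := mulmx_tr_eq0 _ _ uDN; have DNn := mulmx_tr_eq0 _ _ nDN.
apply: (orthogonal_frame_eq0 u n _ J uu nn nu uJ nJ Jf).
- rewrite dotBl dotDl dotZl nu mulr0 addr0 [X in _ - X]dot_mulmx.
  rewrite -mulmxA DNu mulmx0 mxE subr0.
  rewrite dS -[RHS]trGh -sum_contract //.
  by apply: eq_bigr => i _; apply: eq_bigr => j _; rewrite N2u.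
- rewrite dotBl dotDl dotZl nn mulr1 [X in _ - X]dot_mulmx.
  rewrite -mulmxA DNn mulmx0 mxE subr0.
  rewrite dS /E -sum_contract // -big_split big1 // => i _ /=.
  rewrite -big_split big1 // => j _ /=.
  by rewrite N2n mulmx_tr_dot [dot (row j DN) _]dotC; ring.
- have rd (w : 'rV[R]_m.+2) (A : 'M[R]_(m, m.+2)) l :
      dot w (row l A) = (w *m A^T) 0 l by rewrite mulmx_tr_dot row_id.
  apply/rowP => l; rewrite -rd dotBl dotDl dotZl SJ !rd nJ -[_ *m DN *m _]mulmxA DNJ.
  rewrite {1}weingarten linearN /= !trmx_mul Gs hs.
  by rewrite !mulmxN !mulmxA !mxE; ring.
Qed.

End GaussMapAlgebra.

(** * The Laplacian of the Gauss map in a chart *)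

Record minimal_patch {R : realType} {m : nat} (U : set 'rV[R]_m)
    (F N : 'rV[R]_m -> 'rV[R]_m.+2) : Prop := MinimalPatch {
  patch_open : open U;
  patch_smooth : smooth_on U F;
  patch_normal_smooth : smooth_on U N;
  patch_unit : forall x, U x -> dot (F x) (F x) = 1;
  patch_normal_unit : forall x, U x -> dot (N x) (N x) = 1;
  patch_normal_sphere : forall x, U x -> dot (N x) (F x) = 0;
  patch_normal_tangent : forall x v, U x -> dot (N x) ('D_v F x) = 0;
  patch_immersion : forall x v, U x -> 'D_v F x = 0 -> v = 0;
  patch_minimal : forall x, U x -> mean_curvature F N x = 0
}.

Definition jacobian_rows {R : realType} {m k : nat} (F : 'rV[R]_m -> 'rV[R]_k)
  (x : 'rV[R]_m) : 'M[R]_(m, k) := \matrix_i partial i F x.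

(** On the chart this is [invmx] of the first fundamental form; Cramer's formula
    makes its differentiability evident. *)
Definition inverse_form {R : realType} {m k : nat} (F : 'rV[R]_m -> 'rV[R]_k)
  (x : 'rV[R]_m) : 'M[R]_m := (\det (first_form F x))^-1 *: \adj (first_form F x).

(** The opposite of the tangential coordinates of [\sum_ij g^ij F_ij]: with the
    Christoffel symbols, [- g^ij Gamma^k_ij], the first-order coefficients of the
    Laplace-Beltrami operator. *)
Definition drift {R : realType} {m k : nat} (F : 'rV[R]_m -> 'rV[R]_k)
  (x : 'rV[R]_m) : 'rV[R]_m :=
  - ((\sum_i \sum_j inverse_form F x i j *: partial i (partial j F) x)
     *m (jacobian_rows F x)^T *m inverse_form F x).

Section MinimalPatch.
Context {R : realType} {m : nat} {U : set 'rV[R]_m} {F N : 'rV[R]_m -> 'rV[R]_m.+2}.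
Context (patch : minimal_patch U F N).
Let oU := patch_open _ _ _ patch.
Let sF := patch_smooth _ _ _ patch.
Let sN := patch_normal_smooth _ _ _ patch.

Lemma first_formE x : first_form F x = jacobian_rows F x *m (jacobian_rows F x)^T.
Proof. by apply/matrixP => i j; rewrite mulmx_tr_dot !rowK mxE. Qed.

Lemma jacobian_rows_free x : U x -> row_free (jacobian_rows F x).
Proof.
move=> Ux; apply: inj_row_free => v vJ; apply: (patch_immersion _ _ _ patch x) => //.
rewrite derive_coords; last exact: smooth_on_differentiable sF Ux.
rewrite -[RHS]vJ mulmx_sum_row; apply: eq_bigr => i _.
by rewrite rowK.
Qed.

Lemma first_form_unit x : U x -> first_form F x \in unitmx.
Proof.
move=> Ux; rewrite -row_free_unit first_formE; apply: inj_row_free => v vJ.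
apply: (row_free_inj (jacobian_rows_free x Ux)); rewrite mul0mx.
by apply: dot_eq0; rewrite dot_mulmx trmx_mul mulmxA -(mulmxA v) vJ mul0mx mxE.
Qed.

Lemma inverse_formE x : U x -> inverse_form F x = invmx (first_form F x).
Proof. by move=> Ux; rewrite /invmx first_form_unit. Qed.

Lemma inverse_form_mul x : U x -> inverse_form F x *m first_form F x = 1%:M.
Proof. by move=> Ux; rewrite inverse_formE // mulVmx // first_form_unit. Qed.

Lemma inverse_form_sym x : U x -> (inverse_form F x)^T = inverse_form F x.
Proof.
move=> Ux; rewrite inverse_formE // trmx_inv; congr invmx.
by rewrite first_formE trmx_mul trmxK.
Qed.

Lemma inverse_form_gram x : U x -> gram_coefficient (inverse_form F x).
Proof.
move=> Ux; split; first by rewrite inverse_formE // unitmx_inv first_form_unit.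
exists m.+2, (inverse_form F x *m jacobian_rows F x).
rewrite trmx_mul inverse_form_sym // mulmxA -(mulmxA _ _ (_^T)) -first_formE.
by rewrite inverse_form_mul // mul1mx.
Qed.

Lemma smooth_partial {k} i (H : 'rV[R]_m -> 'rV[R]_k) :
  smooth_on U H -> smooth_on U (partial i H).
Proof. exact: smooth_on_derive. Qed.

Lemma partial_comm {k} i j (H : 'rV[R]_m -> 'rV[R]_k) x : U x -> smooth_on U H ->
  partial i (partial j H) x = partial j (partial i H) x.
Proof. by move=> Ux sH; exact: (smooth_on_derive_comm _ _ _ oU Ux sH). Qed.

Lemma partial_dot {k} i (H1 H2 : 'rV[R]_m -> 'rV[R]_k) x : U x ->
  smooth_on U H1 -> smooth_on U H2 ->
  'D_(delta_mx 0 i) (fun y => dot (H1 y) (H2 y)) x =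
  dot (partial i H1 x) (H2 x) + dot (H1 x) (partial i H2 x).
Proof.
by move=> Ux s1 s2; apply: derive_dot;
  [exact: smooth_on_derivable s1 Ux | exact: smooth_on_derivable s2 Ux].
Qed.

Lemma partial_dot_cst {k} i (H1 H2 : 'rV[R]_m -> 'rV[R]_k) c x : U x ->
  smooth_on U H1 -> smooth_on U H2 -> (forall y, U y -> dot (H1 y) (H2 y) = c) ->
  dot (partial i H1 x) (H2 x) + dot (H1 x) (partial i H2 x) = 0.
Proof. by move=> Ux s1 s2 E; exact: (derive_dot_cst _ oU Ux s1 s2 E). Qed.

Lemma dot_partial_position i x : U x -> dot (partial i F x) (F x) = 0.
Proof.
move=> Ux; have := partial_dot_cst i F F 1 x Ux sF sF (patch_unit _ _ _ patch).
by rewrite [dot (F x) _]dotC; lra.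
Qed.

Lemma dot_normal_partial i x : U x -> dot (N x) (partial i F x) = 0.
Proof. exact: patch_normal_tangent. Qed.

Lemma dot_partial_normal i x : U x -> dot (partial i N x) (N x) = 0.
Proof.
move=> Ux; have := partial_dot_cst i N N 1 x Ux sN sN (patch_normal_unit _ _ _ patch).
by rewrite [dot (N x) _]dotC; lra.
Qed.

Lemma dot_partial_normal_position i x : U x -> dot (partial i N x) (F x) = 0.
Proof.
move=> Ux; have := partial_dot_cst i N F 0 x Ux sN sF (patch_normal_sphere _ _ _ patch).
by rewrite dot_normal_partial // addr0.
Qed.

Lemma dot_partial_normal_partial i j x : U x ->
  dot (partial i N x) (partial j F x) = - second_form F N x i j.
Proof.
move=> Ux; have := partial_dot_cst i N (partial j F) 0 x Ux sN (smooth_partial j F sF)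
  (dot_normal_partial j).
by rewrite mxE [dot (N x) _]dotC => /eqP; rewrite addr_eq0 => /eqP.
Qed.

Lemma second_form_sym x : U x -> (second_form F N x)^T = second_form F N x.
Proof.
by move=> Ux; apply/matrixP => i j; rewrite !mxE partial_comm.
Qed.

Let F2 l x : 'M[R]_(m, m.+2) := \matrix_i partial l (partial i F) x.
Let N2 l x : 'M[R]_(m, m.+2) := \matrix_i partial l (partial i N) x.
Let C l x := F2 l x *m (jacobian_rows F x)^T.

Lemma differentiable_first_form x i j : U x ->
  differentiable (fun y => first_form F y i j) x.
Proof.
move=> Ux; rewrite (_ : (fun y => _) = (fun y => dot (partial i F y) (partial j F y))).
  by apply: differentiable_dot; apply: smooth_on_differentiable Ux; exact: smooth_partial.
by apply/funext => y; rewrite mxE.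
Qed.

Lemma differentiable_second_form x i j : U x ->
  differentiable (fun y => second_form F N y i j) x.
Proof.
move=> Ux; rewrite (_ : (fun y => _) = (fun y => dot (partial i (partial j F) y) (N y))).
  apply: differentiable_dot; last exact: smooth_on_differentiable sN Ux.
  by apply: smooth_on_differentiable Ux; do 2!apply: smooth_partial.
by apply/funext => y; rewrite mxE.
Qed.

Lemma differentiable_inverse_form x i j : U x ->
  differentiable (fun y => inverse_form F y i j) x.
Proof.
move=> Ux; have dg := differentiable_first_form x ^~ _ ^~ Ux.
rewrite (_ : (fun y => _) = (fun y => (\det (first_form F y))^-1) *
   (fun y => \adj (first_form F y) i j)); last by apply/funext => y; rewrite mxE.
apply: differentiableM; last exact: differentiable_adj.
apply: (@differentiableV _ _ (fun y => \det (first_form F y))).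
  exact: differentiable_det.
by have := first_form_unit x Ux; rewrite unitmxE unitfE.
Qed.

Lemma derive_first_form l x : U x ->
  'D_(delta_mx 0 l) (first_form F) x = C l x + (C l x)^T.
Proof.
move=> Ux; apply/matrixP => i j.
have dg := differentiable_derivable_mx (first_form F) x (delta_mx 0 l)
  (fun i j => differentiable_first_form x i j Ux).
rewrite -derive_coord //.
rewrite (_ : (fun y => _) = (fun y => dot (partial i F y) (partial j F y))).
  rewrite partial_dot //; try exact: smooth_partial.
  rewrite mxE [in X in _ = _ + X]mxE !mulmx_tr_dot !rowK.
  by rewrite [dot (partial i F x) _]dotC.
by apply/funext => y; rewrite mxE.
Qed.

Lemma derive_inverse_form l x : U x ->
  'D_(delta_mx 0 l) (inverse_form F) x =
  - (inverse_form F x *m (C l x + (C l x)^T) *m inverse_form F x).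
Proof.
move=> Ux.
have dg := differentiable_derivable_mx (first_form F) x (delta_mx 0 l)
  (fun i j => differentiable_first_form x i j Ux).
have dG := differentiable_derivable_mx (inverse_form F) x (delta_mx 0 l)
  (fun i j => differentiable_inverse_form x i j Ux).
have [_ E] := derive_mulmx _ _ _ _ dG dg.
have E0 : 'D_(delta_mx 0 l) (fun y => inverse_form F y *m first_form F y) x = 0.
  rewrite -(derive_cst (1%:M : 'M[R]_m) x (delta_mx 0 l)); apply: near_eq_derive.
  by apply: filterS (open_nbhs_nbhs (conj oU Ux)) => y Uy; rewrite inverse_form_mul.
move: E; rewrite E0 derive_first_form // => /esym /eqP; rewrite addr_eq0 => /eqP E.
have gG : first_form F x *m inverse_form F x = 1%:M.
  by apply: mulmx1C; exact: inverse_form_mul.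
by rewrite -[LHS]mulmx1 -gG mulmxA E mulNmx.
Qed.

Lemma derive_second_form l x i j : U x ->
  'D_(delta_mx 0 l) (second_form F N) x i j =
  dot (partial l (partial i (partial j F)) x) (N x) +
  dot (partial i (partial j F) x) (partial l N x).
Proof.
move=> Ux.
have dh := differentiable_derivable_mx (second_form F N) x (delta_mx 0 l)
  (fun i j => differentiable_second_form x i j Ux).
rewrite -derive_coord //.
rewrite (_ : (fun y => _) = (fun y => dot (partial i (partial j F) y) (N y))).
  by rewrite partial_dot //; do 2!apply: smooth_partial.
by apply/funext => y; rewrite mxE.
Qed.

Lemma derive_mean_curvature l x : U x ->
  \tr ('D_(delta_mx 0 l) (inverse_form F) x *m second_form F N x) +
  \tr (inverse_form F x *m 'D_(delta_mx 0 l) (second_form F N) x) = 0.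
Proof.
move=> Ux.
have dh := differentiable_derivable_mx (second_form F N) x (delta_mx 0 l)
  (fun i j => differentiable_second_form x i j Ux).
have dG := differentiable_derivable_mx (inverse_form F) x (delta_mx 0 l)
  (fun i j => differentiable_inverse_form x i j Ux).
have [d E] := derive_mulmx _ _ _ _ dG dh.
rewrite -linearD /= -E -derive_trace //.
rewrite -(derive_cst (0 : R) x (delta_mx 0 l)); apply: near_eq_derive.
apply: filterS (open_nbhs_nbhs (conj oU Ux)) => y Uy.
by rewrite inverse_formE //; exact: (patch_minimal _ _ _ patch y Uy).
Qed.

(** The Codazzi equation: differentiate [(N_j, F_l) + (N, F_jl) = 0] along [i],
    and use that the third derivatives of [F] are symmetric. *)
Lemma codazzi i j l x : U x ->
  dot (partial i (partial j N) x) (partial l F x) =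
  - 'D_(delta_mx 0 l) (second_form F N) x i j
  + dot (partial i (partial j F) x) (partial l N x)
  - dot (partial l (partial j F) x) (partial i N x)
  - dot (partial l (partial i F) x) (partial j N x).
Proof.
have rearrange (a b b' c c' d D e : R) : a + b + (c + d) = 0 ->
    D = d + e -> c = c' -> b = b' -> a = - D + e - c' - b'.
  by move=> H -> <- <-; lra.
have dot_swap (p p' q : 'rV[R]_m.+2) : p = p' -> dot q p = dot p' q.
  by move=> ->; exact: dotC.
move=> Ux; have sP k (H : 'rV[R]_m -> 'rV[R]_m.+2) : smooth_on U H ->
    smooth_on U (partial k H) by exact: smooth_partial.
have E y : U y ->
    dot (partial j N y) (partial l F y) + dot (N y) (partial j (partial l F) y) = 0.
  move=> Uy.
  exact: (partial_dot_cst j N (partial l F) 0 y Uy sN (sP _ _ sF)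
            (dot_normal_partial l)).
have := derive_cst_on _ _ _ (delta_mx 0 i) oU Ux E.
have dd (H1 H2 : 'rV[R]_m -> 'rV[R]_m.+2) : smooth_on U H1 -> smooth_on U H2 ->
    derivable (fun y => dot (H1 y) (H2 y)) x (delta_mx 0 i).
  move=> s1 s2; apply: diff_derivable; apply: differentiable_dot.
    exact: smooth_on_differentiable s1 Ux.
  exact: smooth_on_differentiable s2 Ux.
have s1 := sP j _ sN; have s2 := sP l _ sF; have s3 := sP j _ s2.
have [_ ->] := is_deriveD (derivableP (dd _ _ s1 s2)) (derivableP (dd _ _ sN s3)).
rewrite (partial_dot i _ _ x Ux s1 s2) (partial_dot i _ _ x Ux sN s3) => H.
have F3 : partial i (partial j (partial l F)) x = partial l (partial i (partial j F)) x.
  apply: etrans (partial_comm i l (partial j F) x Ux (sP j F sF)).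
  apply: near_eq_derive; apply: filterS (open_nbhs_nbhs (conj oU Ux)) => y Uy.
  exact: partial_comm.
apply: (rearrange _ _ _ _ _ _ _ _ H).
- apply: (etrans (derive_second_form l x i j Ux)).
  exact: (congr1 (fun t => t + _) (esym (dot_swap _ _ _ F3))).
- exact: (dot_swap _ _ _ (partial_comm _ _ _ _ Ux sF)).
- exact: (dot_swap _ _ _ (partial_comm _ _ _ _ Ux sF)).
Qed.

(** [Delta N = - |B|^2 N], where [|B|^2 = g^ij (N_i, N_j)] is the energy density
    of the Gauss map. *)
Theorem laplacian_gauss_map x : U x ->
  \sum_i \sum_j inverse_form F x i j *: partial i (partial j N) x =
  - (drift F x *m jacobian_rows N x) -
  \tr (inverse_form F x *m (jacobian_rows N x *m (jacobian_rows N x)^T)) *: N x.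
Proof.
move=> Ux.
have SE (H : 'rV[R]_m -> 'rV[R]_m.+2) :
    \sum_i \sum_j inverse_form F x i j *: row j (\matrix_i0 partial i (partial i0 H) x) =
    \sum_i \sum_j inverse_form F x i j *: partial i (partial j H) x.
  by apply: eq_bigr => i _; apply: eq_bigr => j _; rewrite rowK.
have ortho (v : 'rV[R]_m.+2) (H : 'rV[R]_m -> 'rV[R]_m.+2) :
    (forall i, dot (partial i H x) v = 0) -> v *m (jacobian_rows H x)^T = 0.
  by move=> vH; apply/rowP => i; rewrite mulmx_tr_dot row_id rowK dotC vH mxE.
have ALG := @gauss_map_laplacian_algebra R m (F x) (N x)
  (jacobian_rows F x) (jacobian_rows N x) (F2 ^~ x) (N2 ^~ x)
  (inverse_form F x) (second_form F N x)
  (fun l => 'D_(delta_mx 0 l) (inverse_form F) x)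
  (fun l => 'D_(delta_mx 0 l) (second_form F N) x).
have driftE : drift F x *m jacobian_rows N x =
    - ((\sum_i \sum_j inverse_form F x i j *: row j (F2 i x))
       *m (jacobian_rows F x)^T *m inverse_form F x *m jacobian_rows N x).
  rewrite /drift mulNmx.
  exact: (congr1 (fun T => - (T *m _ *m _ *m _)) (esym (SE F))).
have dot_eq (p p' q q' : 'rV[R]_m.+2) : p = p' -> q = q' -> dot p q = dot p' q'.
  by move=> -> ->.
have sum_eq (d b b' c c' e e' : R) : b = b' -> c = c' -> e = e' ->
  d + b - c - e = d + b' - c' - e' by move=> -> -> ->.
have rF i j : row j (F2 i x) = partial i (partial j F) x by exact: rowK.
have rN i j : row j (N2 i x) = partial i (partial j N) x by exact: rowK.
have rJ j : row j (jacobian_rows F x) = partial j F x by exact: rowK.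
have rD j : row j (jacobian_rows N x) = partial j N x by exact: rowK.
rewrite driftE opprK; apply: (etrans (esym (SE N))); apply: ALG.
- exact: (patch_unit _ _ _ patch).
- exact: (patch_normal_unit _ _ _ patch).
- exact: (patch_normal_sphere _ _ _ patch).
- by apply: ortho => i; exact: dot_partial_position.
- by apply: ortho => i; apply: (etrans (dotC _ _)); exact: dot_normal_partial.
- by apply: ortho => i; exact: dot_partial_normal_position.
- by apply: ortho => i; exact: dot_partial_normal.
- by rewrite -first_formE; exact: inverse_form_mul.
- exact: inverse_form_sym.
- apply/matrixP => i j; rewrite mulmx_tr_dot [RHS]mxE.
  apply: (etrans (dot_eq _ _ _ _ (rD i) (rJ j))); exact: dot_partial_normal_partial.
- exact: second_form_sym.
- by rewrite inverse_formE //; exact: (patch_minimal _ _ _ patch).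
- by move=> l; exact: derive_inverse_form.
- by move=> l; exact: derive_mean_curvature.
- move=> i j l; apply: (etrans (dot_eq _ _ _ _ (rN i j) (rJ l))).
  apply: (etrans (codazzi i j l x Ux)); apply: sum_eq.
  + exact: (dot_eq _ _ _ _ (esym (rF i j)) (esym (rD l))).
  + exact: (dot_eq _ _ _ _ (esym (rF l j)) (esym (rD i))).
  + exact: (dot_eq _ _ _ _ (esym (rF l i)) (esym (rD j))).
- move=> i j; apply: (etrans (dot_eq _ _ _ _ (rN i j) erefl)).
  have := partial_dot_cst i (partial j N) F 0 x Ux (smooth_partial j N sN) sF
    (dot_partial_normal_position j).
  rewrite dot_partial_normal_partial // -{1}(second_form_sym x Ux) mxE.
  by move/eqP; rewrite subr_eq0 => /eqP.
- move=> i j; apply: (etrans (dot_eq _ _ _ _ (rN i j) erefl)).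
  have := partial_dot_cst i (partial j N) N 0 x Ux (smooth_partial j N sN) sN
    (dot_partial_normal j).
  move/eqP; rewrite addr_eq0 => /eqP E; apply: (etrans E).
  exact: (congr1 -%R (dot_eq _ _ _ _ (esym (rD j)) (esym (rD i)))).
Qed.

Lemma elliptic_op_gauss_map (a : 'rV[R]_m.+2) x : U x ->
  elliptic_op (inverse_form F x) (drift F x) (fun y => dot (N y) a) x =
  - \tr (inverse_form F x *m (jacobian_rows N x *m (jacobian_rows N x)^T)) * dot (N x) a.
Proof.
move=> Ux; have sP := smooth_partial.
have D1 j y : U y -> 'D_(delta_mx 0 j) (fun y => dot (N y) a) y = dot (partial j N y) a.
  by move=> Uy; apply: derive_dotr; exact: smooth_on_derivable sN Uy.
have D2 i j : 'D_(delta_mx 0 i) ('D_(delta_mx 0 j) (fun y => dot (N y) a)) x =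
    dot (partial i (partial j N) x) a.
  apply: (etrans (derive_eq_on _ _ _ _ oU Ux (D1 j))).
  by apply: derive_dotr; exact: smooth_on_derivable (sP _ j _ sN) Ux.
have := congr1 (fun v => dot v a) (laplacian_gauss_map x Ux) => /=.
rewrite dotBl dotNl dotZl => E.
have S2 : \sum_i \sum_j inverse_form F x i j * dot (partial i (partial j N) x) a =
    dot (\sum_i \sum_j inverse_form F x i j *: partial i (partial j N) x) a.
  rewrite dot_suml; apply: eq_bigr => i _; rewrite dot_suml; apply: eq_bigr => j _.
  by rewrite dotZl.
have S1 : \sum_k drift F x 0 k * dot (partial k N x) a =
    dot (drift F x *m jacobian_rows N x) a.
  rewrite mulmx_sum_row dot_suml; apply: eq_bigr => k _.
  by rewrite rowK dotZl.
transitivity (\sum_i \sum_j inverse_form F x i j * dot (partial i (partial j N) x) a +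
   \sum_k drift F x 0 k * dot (partial k N x) a).
  congr (_ + _).
    by apply: eq_bigr => i _; apply: eq_bigr => j _; rewrite D2.
  by apply: eq_bigr => k _; congr (_ * _); exact: D1.
by rewrite S2 S1 E mulNr addrAC addNr add0r.
Qed.

Lemma gauss_map_energy_ge0 x : U x ->
  0 <= \tr (inverse_form F x *m (jacobian_rows N x *m (jacobian_rows N x)^T)).
Proof.
move=> Ux; have [_ [p [Q ->]]] := inverse_form_gram x Ux.
rewrite -mulmxA mxtrace_mulC.
by have := mxtrace_gram_ge0 (Q^T *m jacobian_rows N x); rewrite trmx_mul trmxK !mulmxA.
Qed.

Lemma inverse_form_continuous x : U x -> {for x, continuous (inverse_form F)}.
Proof.
move=> Ux; apply: continuous_at_mx => i j.
by apply: differentiable_continuous; exact: differentiable_inverse_form.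
Qed.

Lemma drift_continuous x : U x -> {for x, continuous (drift F)}.
Proof.
move=> Ux; apply: continuous_at_mx => i k.
have cG a b : {for x, continuous (fun y => inverse_form F y a b)}.
  by apply: continuous_at_entry; exact: inverse_form_continuous.
have cP a b c : {for x, continuous (fun y => partial a (partial b F) y 0 c)}.
  apply: continuous_at_entry.
  exact: smooth_on_continuous (smooth_partial a _ (smooth_partial b _ sF)) Ux.
have cJ a c : {for x, continuous (fun y => partial a F y 0 c)}.
  by apply: continuous_at_entry; exact: smooth_on_continuous (smooth_partial a _ sF) Ux.
rewrite (_ : (fun y => _) = (fun y => 0 - \sum_l (\sum_c
   (\sum_a \sum_b inverse_form F y a b * partial a (partial b F) y 0 c) *
   partial l F y 0 c) * inverse_form F y l k)); last first.
  apply/funext => y; rewrite ord1 /drift mxE sub0r; congr (- _).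
  rewrite mxE; apply: eq_bigr => l _; congr (_ * _).
  rewrite mxE; apply: eq_bigr => c _; rewrite !mxE; congr (_ * _).
  rewrite summxE; apply: eq_bigr => a _; rewrite summxE; apply: eq_bigr => b _.
  by rewrite mxE.
apply: continuous_at_sub; first exact: continuous_at_cst.
apply: continuous_at_sum => l; apply: continuous_at_mul => //.
apply: continuous_at_sum => c; apply: continuous_at_mul => //.
apply: continuous_at_sum => a; apply: continuous_at_sum => b.
exact: continuous_at_mul.
Qed.

(** Each component of the Gauss map is superharmonic where it is nonnegative,
    so there it obeys the strong minimum principle. *)
Lemma gauss_map_strong_minimum (V : set 'rV[R]_m) (a : 'rV[R]_m.+2) x :
  open V -> V `<=` U -> V x ->
  (forall y, V y -> 0 <= dot (N y) a) ->
  (forall y, V y -> dot (N x) a <= dot (N y) a) ->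
  \forall y \near x, dot (N y) a = dot (N x) a.
Proof.
move=> oV VU Vx pos min.
apply: (strong_minimum_principle V (inverse_form F) (drift F)
  (fun y => dot (N y) a) x oV Vx _ _ _ _ _ min).
- move=> y /VU Uy; split.
    by apply: differentiable_dot => //; exact: smooth_on_differentiable sN Uy.
  move=> u; apply: (@near_eq_differentiable _ _ _ (fun y => dot ('D_u N y) a)).
    apply: filterS (open_nbhs_nbhs (conj oU Uy)) => z Uz; apply: esym.
    by apply: derive_dotr; exact: smooth_on_derivable sN Uz.
  apply: differentiable_dot => //.
  exact: smooth_on_differentiable (smooth_on_derive u sN) Uy.
- by move=> y /VU; exact: inverse_form_gram.
- by move=> y /VU; exact: inverse_form_continuous.
- by move=> y /VU; exact: drift_continuous.
move=> y Vy; rewrite elliptic_op_gauss_map; last exact: VU.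
by rewrite mulNr oppr_le0 mulr_ge0 ?gauss_map_energy_ge0 ?pos //; exact: VU.
Qed.

End MinimalPatch.

(** * Angles in a slit plane *)

Section SlitPlane.
Context {R : realType}.
Implicit Types u v : R.

(** Twice the quantity [l] of [slit_coordinates]; it vanishes exactly on the ray
    [u = 0, v >= 0]. *)
Definition slit_radius u v : R := Num.sqrt (u ^+ 2 + v ^+ 2) - v.

(** The tangent of half the angle between [(u, v)] and [(0, -1)]: an increasing
    function of the angle on the plane slit along [u = 0, v >= 0]. *)
Definition half_angle_tan u v : R := u / slit_radius u v.

Lemma slit_radius_gt0 u v : ~ (u = 0 /\ 0 <= v) -> 0 < slit_radius u v.
Proof.
move=> uv; rewrite /slit_radius subr_gt0.
have s0 : 0 <= u ^+ 2 + v ^+ 2 by rewrite addr_ge0 ?sqr_ge0.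
have [v0|v0] := ltrP v 0; first exact: lt_le_trans v0 (sqrtr_ge0 _).
have u0 : u != 0 by apply/eqP => u0; apply: uv.
rewrite -[X in X < _](ger0_norm v0) -sqrtr_sqr ltr_sqrt; last first.
  by rewrite ltr_wpDr ?sqr_ge0 // exprn_even_gt0.
by rewrite ltrDr exprn_even_gt0.
Qed.

(** The tangent half-angle formulas: with [l] half of the slit radius and [t] the
    tangent of half the angle, [(u, v) = l (2 t, t^2 - 1)]. *)
Lemma slit_coordinates u v : 0 < slit_radius u v ->
  u = slit_radius u v * half_angle_tan u v /\
  v = slit_radius u v / 2 * (half_angle_tan u v ^+ 2 - 1).
Proof.
move=> r0; have rn : slit_radius u v != 0 by rewrite gt_eqF.
have uE : u = slit_radius u v * half_angle_tan u v.
  by rewrite /half_angle_tan mulrC divfK.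
split=> //.
have s0 : 0 <= u ^+ 2 + v ^+ 2 by rewrite addr_ge0 ?sqr_ge0.
have sq : (slit_radius u v + v) ^+ 2 = u ^+ 2 + v ^+ 2.
  by rewrite /slit_radius subrK sqr_sqrtr.
move: sq; rewrite {2}uE; move: (slit_radius u v) (half_angle_tan u v) rn => r t rn sq.
apply: (mulfI rn); apply: (@mulfI _ 2); first by rewrite pnatr_eq0.
have -> : 2 * (r * (r / 2 * (t ^+ 2 - 1))) = (r * t) ^+ 2 - r ^+ 2 by field.
by move: sq; rewrite !expr2; lra.
Qed.

Lemma continuous_half_angle_tan {T : topologicalType} (a b : T -> R) p :
  {for p, continuous a} -> {for p, continuous b} -> 0 < slit_radius (a p) (b p) ->
  {for p, continuous (fun q => half_angle_tan (a q) (b q))}.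
Proof.
move=> ca cb r0.
have cs : {for p, continuous (fun q => a q ^+ 2 + b q ^+ 2)}.
  apply: continuous_at_add.
    exact: (continuous_at_mul a a p ca ca).
  exact: (continuous_at_mul b b p cb cb).
have csq : {for p, continuous (fun q => Num.sqrt (a q ^+ 2 + b q ^+ 2))}.
  apply: (@continuous_comp _ _ _ (fun q => a q ^+ 2 + b q ^+ 2) (@Num.sqrt R)) => //.
  exact: sqrt_continuous.
have cr := continuous_at_sub _ _ p csq cb.
apply: continuous_at_mul => //.
by apply: (cvgV _ cr); rewrite gt_eqF.
Qed.

End SlitPlane.

(** * From charts to the hypersurface *)

Section Charts.
Context {R : realType} {m : nat} {M : topologicalType} (c : chart R m M).
Context (cc : is_chart c).

Lemma chart_near (P : M -> Prop) p : chart_dom c p ->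
  (\forall y \near chart_map c p, P (chart_inv c y)) -> \forall q \near p, P q.
Proof.
have [oD oI invK cmap _] := cc => Dp nP.
have n1 : \forall q \near p, P (chart_inv c (chart_map c q)) by exact: (cmap p Dp _ nP).
have n2 : \forall q \near p, chart_dom c q by exact: open_nbhs_nbhs.
by apply: filterS2 n1 n2 => q Pq Dq; rewrite -(invK q Dq).
Qed.

Lemma near_chart (P : M -> Prop) p : chart_dom c p ->
  (\forall q \near p, P q) -> exists V : set 'rV[R]_m,
  [/\ open V, V `<=` chart_img c, V (chart_map c p) & forall y, V y -> P (chart_inv c y)].
Proof.
have [oD oI invK _ cinv] := cc => Dp nP.
have Ip : chart_img c (chart_map c p) by exists p.
have n1 : \forall y \near chart_map c p, P (chart_inv c y).
  by apply: (cinv _ Ip); rewrite invK.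
have n2 : \forall y \near chart_map c p, chart_img c y by exact: open_nbhs_nbhs.
pose W := [set y | P (chart_inv c y) /\ chart_img c y].
exists W°; split; first exact: open_interior.
- by move=> y /interior_subset [].
- exact: (filterI n1 n2).
- by move=> y /interior_subset [].
Qed.

End Charts.

Section Hypersurface.
Context {R : realType} {m : nat} {M : topologicalType} {A : set (chart R m M)}.
Context {f gam : M -> 'rV[R]_m.+2}.
Context (hM : compact_connected_manifold A).
Context (hf : @sphere_hypersurface R m.+1 M A f).
Context (hgam : @gauss_map R m.+1 M A f gam).
Context (hmin : @minimal R m.+1 M A f gam).

Lemma atlas_chart c : A c -> is_chart c.
Proof. by have [_ _ _ _ [h _ _]] := hM; exact: h. Qed.

Lemma chart_patch c : A c ->
  minimal_patch (chart_img c) (f \o chart_inv c) (gam \o chart_inv c).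
Proof.
move=> Ac; have [_ oI _ _ _] := atlas_chart c Ac.
have [[sf inj] fS] := hf; have [sg gS gf gt] := hgam.
have df x : chart_img c x -> differentiable (f \o chart_inv c) x.
  exact: smooth_on_differentiable (sf c Ac).
split=> //; first exact: sf; first exact: sg.
- by move=> x Ix; exact: fS.
- by move=> x Ix; exact: gS.
- by move=> x Ix; exact: gf.
- by move=> x v Ix; rewrite deriveE; [exact: gt | exact: df].
- move=> x v Ix; rewrite deriveE; last exact: df.
  by move=> dv; apply: (inj c x Ac Ix); rewrite dv linear0.
- by move=> x Ix; exact: hmin.
Qed.

Lemma smooth_map_continuous {k} (g : M -> 'rV[R]_k) p : smooth_map A g ->
  {for p, continuous g}.
Proof.
move=> sg; have [_ _ _ _ [hc cover _]] := hM; have [c Ac Dp] := cover p.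
have [oD oI invK cmap _] := hc c Ac.
have Ip : chart_img c (chart_map c p) by exists p.
move=> W nW.
have n : \forall y \near chart_map c p, W ((g \o chart_inv c) y).
  by apply: (smooth_on_continuous (sg c Ac) Ip); rewrite /= invK.
exact: (chart_near c (hc c Ac) (fun q => W (g q)) p Dp n).
Qed.

Lemma gauss_continuous a p : {for p, continuous (fun q => dot (gam q) a)}.
Proof.
apply: continuous_at_dot; last exact: (@cst_continuous M 'rV[R]_m.+2 a p).
by apply: smooth_map_continuous; have [] := hgam.
Qed.

Lemma gauss_strong_minimum a p :
  (\forall q \near p, 0 <= dot (gam q) a) ->
  (\forall q \near p, dot (gam p) a <= dot (gam q) a) ->
  \forall q \near p, dot (gam q) a = dot (gam p) a.
Proof.
move=> pos min; have [_ _ _ _ [hc cover _]] := hM; have [c Ac Dp] := cover p.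
have [_ _ invK _ _] := hc c Ac.
have [V [oV VI Vp VP]] := near_chart c (hc c Ac) _ p Dp (filterI pos min).
apply: (chart_near c (hc c Ac) _ p Dp).
have := gauss_map_strong_minimum (chart_patch c Ac) V a (chart_map c p) oV VI Vp.
rewrite /= invK //; apply=> y /VP [] //.
Qed.

(** Connectedness, for a level set that is open by hypothesis. *)
Lemma locally_constant (h : M -> R) (t : R) :
  (forall p, {for p, continuous h}) -> (exists p, h p = t) ->
  (forall p, h p = t -> \forall q \near p, h q = t) -> forall q, h q = t.
Proof.
move=> ch [p hp] loc q; have [_ _ conn _ _] := hM.
have : [set p | h p = t] = [set: M].
  apply: conn; first by exists p.
  - exists [set p | h p = t]; last by rewrite setTI.
    by rewrite openE => x /loc.
  - exists [set p | h p = t]; last by rewrite setTI.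
    have /continuous_closedP /(_ _ (@closed_eq R t)) : continuous h by [].
    exact.
by move=> E; have : [set: M] q by []; rewrite -E.
Qed.

Lemma attains_min (h : M -> R) : (forall p, {for p, continuous h}) ->
  exists p, forall q, h p <= h q.
Proof.
move=> ch; have [_ cM _ M0 _] := hM.
have [p _ pm] := compact_min [set: M] h cM M0 (fun p _ => ch p).
by exists p => q; exact: pm.
Qed.

Lemma gauss_positive_constant a : (forall p, 0 < dot (gam p) a) ->
  forall p q, dot (gam p) a = dot (gam q) a.
Proof.
move=> pos; have [p0 min] := attains_min _ (gauss_continuous a).
suff E q : dot (gam q) a = dot (gam p0) a by move=> p q; rewrite !E.
apply: (locally_constant (fun x => dot (gam x) a) _ (gauss_continuous a)) => [|p /= E].
  by exists p0.
rewrite -E; apply: gauss_strong_minimum.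
  by apply: nearW => x; exact: ltW (pos x).
by apply: nearW => x; rewrite E.
Qed.

(** One positive component dominates every other one: a component plus a large
    multiple of the positive one is positive, and both are constant. *)
Lemma gauss_constant a : (forall p, 0 < dot (gam p) a) -> forall p q, gam p = gam q.
Proof.
move=> pos p q; apply/rowP => i.
pose d : 'rV[R]_m.+2 := delta_mx 0 i.
have [p1 min] := attains_min _ (gauss_continuous d).
pose s := dot (gam p) a; have s0 : 0 < s by exact: pos.
have sE x : dot (gam x) a = s by exact: gauss_positive_constant.
pose K := (`|dot (gam p1) d| + 1) / s.
have posK x : 0 < dot (gam x) (d + K *: a).
  rewrite dotDr dotZr sE divfK ?gt_eqF //.
  by have := min x; have := ler_norm (- dot (gam p1) d); rewrite normrN; lra.
have := gauss_positive_constant _ posK p q.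
by rewrite !dotDr !dotZr !sE !dot_delta => /addIr.
Qed.

(** The angle of [(u, v)] is measured by its half-angle tangent [t].  For
    [a = (t0^2 - 1) e1 - 2 t0 e2], where [t0] is the maximum of [t], the component
    [(gam, a)] is a positive multiple of [(t0 - t) (1 + t t0)], hence nonnegative
    near every point where [t = t0]. *)
Lemma gauss_slit_constant e1 e2 :
  (forall p, ~ (dot (gam p) e1 = 0 /\ 0 <= dot (gam p) e2)) ->
  forall p q, gam p = gam q.
Proof.
move=> slit.
pose u p := dot (gam p) e1; pose v p := dot (gam p) e2.
pose r p := slit_radius (u p) (v p); pose t p := half_angle_tan (u p) (v p).
have r0 p : 0 < r p by exact: (slit_radius_gt0 _ _ (slit p)).
have uE p : u p = r p * t p by have [] := slit_coordinates _ _ (r0 p).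
have vE p : v p = r p / 2 * (t p ^+ 2 - 1) by have [] := slit_coordinates _ _ (r0 p).
have ct p : {for p, continuous t}.
  apply: continuous_half_angle_tan; last exact: r0.
    exact: gauss_continuous.
  exact: gauss_continuous.
have [p0 tmax] : exists p0, forall p, t p <= t p0.
  have [|p0 h] := attains_min (fun p => 0 - t p).
    by move=> p; apply: continuous_at_sub => //; exact: continuous_at_cst.
  by exists p0 => p; have := h p; rewrite !sub0r lerN2.
set t0 := t p0 in tmax.
have pos p : 0 < r p * (t0 ^+ 2 + 1) ^+ 2.
  by rewrite mulr_gt0 // exprn_gt0 // ltr_wpDl ?sqr_ge0.
have tE : forall p, t p = t0.
  apply: (locally_constant t t0 ct); first by exists p0.
  move=> p tp.
  pose a := (t0 ^+ 2 - 1) *: e1 - (2 * t0) *: e2.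
  have aE q : dot (gam q) a = r q * (t0 - t q) * (1 + t q * t0).
    by rewrite dotBr !dotZr -/(u q) -/(v q) uE vE; field.
  have ap : dot (gam p) a = 0 by rewrite aE tp subrr mulr0 mul0r.
  have n1 : \forall q \near p, 0 < 1 + t q * t0.
    apply: (cvgr_gt _ (continuous_at_add _ _ p (continuous_at_cst 1 p)
      (continuous_at_mul _ _ p (ct p) (continuous_at_cst t0 p)))).
    by rewrite tp -expr2 ltr_wpDr ?sqr_ge0.
  have n2 : \forall q \near p, 0 <= dot (gam q) a.
    apply: filterS n1 => q q1; rewrite aE; apply: mulr_ge0; last exact: ltW.
    by apply: mulr_ge0; [exact: ltW | rewrite subr_ge0].
  have n3 : \forall q \near p, dot (gam q) a = dot (gam p) a.
    by apply: gauss_strong_minimum => //; rewrite ap.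
  apply: filterS2 n1 n3 => q q1; rewrite ap aE => /eqP.
  by rewrite mulf_eq0 (gt_eqF q1) orbF mulf_eq0 gt_eqF //= subr_eq0 => /eqP.
apply: (gauss_constant ((2 * t0) *: e1 + (t0 ^+ 2 - 1) *: e2)) => p.
rewrite dotDr !dotZr -/(u p) -/(v p) uE vE tE.
rewrite [X in 0 < X](_ : _ = (r p * (t0 ^+ 2 + 1) ^+ 2) / 2); last by field.
by rewrite divr_gt0.
Qed.

(** To reach a point [q] of the equator, take a point [p] where [(f, q)] is
    maximal.  In the frame of [f p], [g] and the tangent space, criticality leaves
    [q] only its component along [f p]. *)
Lemma gauss_constant_equator (g : 'rV[R]_m.+2) : (0 < m)%N ->
  (forall p, gam p = g) ->
  f @` [set: M] = [set x | unit_sphere R m.+1 x /\ dot x g = 0].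
Proof.
move=> m0 gE; have [[sf inj] fS] := hf; have [sg gS gf gt] := hgam.
apply/seteqP; split => [_ [p _ <-]|q [qS qg]].
  by split; [exact: fS | rewrite dotC -(gE p); exact: gf].
pose h p := dot (f p) q.
have ch p : {for p, continuous h}.
  apply: continuous_at_dot; last exact: (@cst_continuous M 'rV[R]_m.+2 q p).
  exact: smooth_map_continuous.
have [p hp] : exists p, forall p', h p' <= h p.
  have [|p hp] := attains_min (fun p => 0 - h p).
    by move=> p; apply: continuous_at_sub => //; exact: continuous_at_cst.
  by exists p => p'; have := hp p'; rewrite !sub0r lerN2.
have [_ _ _ _ [hc cover _]] := hM; have [c Ac Dp] := cover p.
have [_ oI invK _ _] := hc c Ac.
have patch := chart_patch c Ac.
pose F := f \o chart_inv c; pose x := chart_map c p.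
have Ix : chart_img c x by exists p.
have Fx : F x = f p by rewrite /F /= invK.
have dF y : chart_img c y -> differentiable F y.
  exact: smooth_on_differentiable (sf c Ac).
have crit w : dot ('D_w F x) q = 0.
  rewrite -derive_dotr; last by apply: diff_derivable; exact: dF.
  have nI : \forall y \near x, chart_img c y by exact: open_nbhs_nbhs.
  have : 'D_w (fun y => - dot (F y) q) x = 0.
    apply: derive_local_min.
      apply: filterS nI => y Iy; apply: derivableN; apply: diff_derivable.
      by apply: differentiable_dot => //; exact: dF.
    by apply: filterS nI => y _; rewrite lerN2 Fx; exact: hp.
  rewrite deriveN; first by move/eqP; rewrite oppr_eq0 => /eqP.
  by apply: diff_derivable; apply: differentiable_dot => //; exact: dF.
have FF : dot (F x) (F x) = 1 by exact: fS.
have orthoJ (z : 'rV[R]_m.+2) : (forall i, dot (partial i F x) z = 0) ->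
    z *m (jacobian_rows F x)^T = 0.
  by move=> zF; apply/rowP => i; rewrite mulmx_tr_dot row_id rowK dotC zF mxE.
have FJ : F x *m (jacobian_rows F x)^T = 0.
  by apply: orthoJ => i; exact: (dot_partial_position patch).
have gFx : dot g (F x) = 0 by rewrite Fx -(gE p); exact: gf.
have gJ : g *m (jacobian_rows F x)^T = 0.
  apply: orthoJ => i; rewrite dotC -(gE (chart_inv c x)).
  exact: (dot_normal_partial patch).
have gg : dot g g = 1 by rewrite -(gE p); exact: gS.
have qE : q - h p *: F x = 0.
  apply: (orthogonal_frame_eq0 (F x) g _ (jacobian_rows F x) FF gg gFx FJ gJ).
  - exact: (jacobian_rows_free patch x Ix).
  - by rewrite dotBl dotZl FF Fx dotC mulr1 subrr.
  - by rewrite dotBl dotZl qg [dot (F x) g]dotC gFx mulr0 subrr.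
  - rewrite mulmxBl -scalemxAl FJ scaler0 subr0; apply: orthoJ => i; exact: crit.
have {}qE : q = h p *: f p by rewrite -Fx; apply/eqP; rewrite -subr_eq0 qE.
have [s sE] : exists s, h p = s by exists (h p).
rewrite sE in qE hp.
have : s ^+ 2 = 1.
  move: (qS : dot q q = 1).
  by rewrite {1 2}qE dotZl dotZr (fS p : dot _ _ = 1) mulr1 expr2.
move/eqP; rewrite sqrf_eq1 => /orP[] /eqP s1.
  by exists p => //; rewrite [RHS]qE s1 scale1r.
(* The maximum -1 of the inner product with q would be attained everywhere. *)
have fE p' : f p' = - q.
  apply/eqP; rewrite -subr_eq0 opprK; apply/eqP; apply: dot_eq0.
  apply/eqP; rewrite eq_le dot_ge0 andbT dotDl !dotDr (dotC q (f p')).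
  have := hp p'; rewrite s1 /h (fS p' : dot _ _ = 1) (qS : dot _ _ = 1); lra.
pose w : 'rV[R]_m := const_mx 1.
have : w = 0.
  apply: (patch_immersion _ _ _ patch x w Ix).
  rewrite -(derive_cst (- q) x w); congr ('D_w _ x).
  by apply/funext => y; exact: fE.
move/rowP => /(_ (Ordinal m0)); rewrite !mxE => /eqP.
by rewrite oner_eq0.
Qed.

End Hypersurface.

Theorem theorem2p3 (R : realType) (n : nat) (hn : (2 <= n)%N)
  (M : topologicalType) (A : set (chart R n.-1 M))
  (f gam : M -> 'rV[R]_n.+1)
  (hM : compact_connected_manifold A)
  (hf : sphere_hypersurface A f)
  (hgam : gauss_map A f gam)
  (hmin : minimal A f gam)
  (e1 e2 : 'rV[R]_n.+1)
  (he1 : unit_sphere R n e1) (he2 : unit_sphere R n e2)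
  (he12 : dot e1 e2 = 0)
  (homit : gam @` [set: M] `<=` unit_sphere R n `\` half_equator e1 e2) :
  is_equator (f @` [set: M]).
Proof.
case: n hn A f gam hM hf hgam hmin e1 e2 he1 he2 he12 homit => // m m0 A f gam.
move=> hM hf hgam hmin e1 e2 _ _ _ homit.
have gS p : unit_sphere R m.+1 (gam p) by have [_ h _ _] := hgam.
have slit p : ~ (dot (gam p) e1 = 0 /\ 0 <= dot (gam p) e2).
  have [|_ out [h1 h2]] := homit (gam p); first by exists p.
  by apply: out; split.
have cst := gauss_slit_constant hM hf hgam hmin e1 e2 slit.
have [_ _ _ [p _] _] := hM.
exists (gam p) => //.
by apply: (gauss_constant_equator hM hf hgam hmin) => // q; exact: cst.
Qed.
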